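(* Let $F$ be a field and let $\mathcal{A},\mathcal{A}'$ be finitely presented $F$-algebras, each of which has a finite-dimensional representation. Then the direct product $\mathcal{A}\times\mathcal{A}'$ is rank-stable if and only if both $\mathcal{A}$ and $\mathcal{A}'$ are rank-stable.
   Context: Algebras are associative and unital over a field $F$; $F\langle x_1,\dots,x_d\rangle$ denotes the free associative unital algebra (non-commutative polynomials). A finite-dimensional representation of an algebra is a unital algebra homomorphism to $M_n(F)$ for some $n\ge1$. (The direct product of two finitely presented algebras is finitely presented.) For $A\in M_n(F)$ let $\operatorname{rank}(A)=\dim_F\operatorname{Im}A$ and let $\operatorname{rk}(A)=\frac1n\operatorname{rank}(A)$ (normalized rank). For $A\in M_n(F)$, $\widehat{A}$ is the finitely supported $\mathbb{N}\times\mathbb{N}$ matrix that agrees with $A$ in entries $(i,j)$ with $1\le i,j\le n$ and is zero elsewhere. When matrices in $M_n(F)$ are substituted into a non-commutative polynomial, constant terms are interpreted as scalar $n\times n$ matrices. A finitely presented algebra $F\langle x_1,\dots,x_d\rangle/\langle P_1,\dots,P_r\rangle$ is rank-stable if for every $\varepsilon>0$ there exists $\delta>0$ such that for every $n\ge 1$ and every tuple $A_1,\dots,A_d\in M_n(F)$ with $\operatorname{rk}P_i(A_1,\dots,A_d)<\delta$ for all $1\le i\le r$, there exist $n'\ge 1$ and $B_1,\dots,B_d\in M_{n'}(F)$ with $P_i(B_1,\dots,B_d)=0$ for all $1\le i\le r$ and $\operatorname{rank}(\widehat{A_i}-\widehat{B_i})<\varepsilon n$ for all $1\le i\le d$. (This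 property does not depend on the chosen finite presentation of the algebra.) *)

(* Defs.v *)
From mathcomp Require Import all_boot all_order all_algebra reals.
From mathcomp Require Import monalg.

Set Implicit Arguments.
Unset Strict Implicit.
Unset Printing Implicit Defensive.

Import Order.TTheory GRing.Theory Num.Theory.
Local Open Scope ring_scope.

(* F<x_0, ..., x_(d-1)>, as the algebra of the free monoid on 'I_d. *)
Notation ncpoly F d := {malg F[{fmonom 'I_d}]}.

Definition nceval (F : fieldType) (S : algType F) (d : nat) (a : 'I_d -> S)
    (p : ncpoly F d) : S :=
  mmap (fun c : F => c%:A) (fun m : {fmonom 'I_d} => \prod_(i <- m) a i) p.

Definition in_ideal (F : fieldType) (d r : nat) (P : 'I_r -> ncpoly F d)
    (p : ncpoly F d) : Prop :=
  exists s : seq (ncpoly F d * 'I_r * ncpoly F d),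
    p = \sum_(t <- s) t.1.1 * P t.1.2 * t.2.

(* A is isomorphic to F<x_0, ..., x_(d-1)> / <P_0, ..., P_(r-1)>, the
   isomorphism being given by the induced surjection from the free algebra. *)
Definition presents (F : fieldType) (d r : nat) (P : 'I_r -> ncpoly F d)
    (A : algType F) : Prop :=
  exists f : {lrmorphism ncpoly F d -> A},
    (forall a : A, exists p, f p = a) /\
    (forall p, f p = 0 <-> in_ideal P p).

Definition finitely_presented (F : fieldType) (A : algType F) : Prop :=
  exists (d r : nat) (P : 'I_r -> ncpoly F d), presents P A.

(* Matrix sizes n >= 1 are written n.+1 here and below. *)
Definition has_findim_rep (F : fieldType) (A : algType F) : Prop :=
  exists n : nat, inhabited {lrmorphism A -> 'M[F]_n.+1}.

Definition normalized_rank (R : realType) (F : fieldType) (n : nat)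
    (A : 'M[F]_n.+1) : R :=
  (\rank A)%:R / n.+1%:R.

(* Extension of A by zero to an N x N matrix, with row and column indices
   counted from 0. *)
Definition hat (F : fieldType) (n : nat) (A : 'M[F]_n) (i j : nat) : F :=
  match insub i, insub j with
  | Some i', Some j' => A i' j'
  | _, _ => 0
  end.

(* The rank of the infinite matrix hat A - hat B; all the entries outside the
   top left block of size maxn n n' vanish. *)
Definition rank_hatB (F : fieldType) (n n' : nat) (A : 'M[F]_n)
    (B : 'M[F]_n') : nat :=
  \rank (\matrix_(i < maxn n n', j < maxn n n') (hat A i j - hat B i j)).

Definition rank_stable_rels (R : realType) (F : fieldType) (d r : nat)
    (P : 'I_r -> ncpoly F d) : Prop :=
  forall eps : R, 0 < eps -> exists2 delta : R, 0 < delta &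
    forall (n : nat) (A : 'I_d -> 'M[F]_n.+1),
      (forall i, normalized_rank R (nceval A (P i)) < delta) ->
      exists (n' : nat) (B : 'I_d -> 'M[F]_n'.+1),
        (forall i, nceval B (P i) = 0) /\
        (forall i, (rank_hatB (A i) (B i))%:R < eps * n.+1%:R).

(* For a finitely presented algebra this does not depend on the choice of the
   finite presentation. *)
Definition rank_stable (R : realType) (F : fieldType) (A : algType F) : Prop :=
  exists (d r : nat) (P : 'I_r -> ncpoly F d),
    presents P A /\ rank_stable_rels R P.

(* Main.v *)
(* An algebra homomorphism into matrices is compared with an approximate one
   through an approximate intertwiner T: B_i T - T A_i has small rank for all i,
   and T has rank close to both matrix sizes.  Rank stability is equivalent to
   this basis-free version of it: zero-padding or restricting an exact solution
   to an invariant subspace controls its size, and conversely a conjugation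
   brings T close to the rectangular identity matrix.

   If A x A' is stable, with e a polynomial representing (1, 0), then A is
   presented by the relations of A x A' together with 1 - e.  An exact solution
   W for A x A' near an approximate solution for A has e(W) an idempotent close
   to 1, and the restriction of W to the image of e(W) is a solution for A.

   Conversely, A x A' is generated by an idempotent e and the generators of both
   factors.  In an approximate solution e is close to a true idempotent, whose
   two corners carry approximate solutions for A and A'.  They are corrected
   separately and added.  A corner of small relative dimension yields no
   information and is replaced by a fixed representation; matrices of small size
   are already exact solutions. *)

From HB Require Import structures.
From mathcomp Require Import all_boot all_order all_algebra reals.
From mathcomp Require Import finmap monalg zify.
Require Import Defs.

Set Implicit Arguments.
Unset Strict Implicit.
Unset Printing Implicit Defensive.

Import Order.TTheory GRing.Theory Num.Theory.
Local Open Scope ring_scope.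

(** * Evaluation of non-commutative polynomials *)

Lemma rmorph_twist (S S' : pzRingType) (h : {rmorphism S -> S'}) (b u v c : S) :
  h (b * u - v * c) = h b * h u - h v * h c.
Proof. by rewrite rmorphB !rmorphM. Qed.

Lemma mulr_swap (S : pzRingType) (x y z : S) :
  y * x = x * y -> x * (y * z) = y * (x * z).
Proof. by move=> yx; rewrite !mulrA yx. Qed.

(* An alias of [ncpoly F d]: the canonical algebra structure of the type of
   monoid algebras is only available for commutative monoids. *)
Definition ncalg (F : fieldType) (d : nat) : Type := ncpoly F d.

HB.instance Definition _ (F : fieldType) (d : nat) :=
  GRing.Lalgebra.copy (ncalg F d) (ncpoly F d : Type).

Lemma ncpoly_scalerAr (F : fieldType) (d : nat) (c : F) (p q : ncpoly F d) :
  c *: (p * q) = p * (c *: q).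
Proof.
have pc : p * malgC c = malgC c * p.
  rewrite !malgM_def fgmulUg fgmulgU.
  by apply: eq_bigr => m _; rewrite mul1m mulm1 mulrC.
rewrite -mul_malgC -[c *: q]mul_malgC; exact: mulr_swap.
Qed.

HB.instance Definition _ (F : fieldType) (d : nat) :=
  GRing.Lalgebra_isAlgebra.Build F (ncalg F d) (@ncpoly_scalerAr F d).

Definition ncvar (F : fieldType) (d : nat) (i : 'I_d) : ncpoly F d :=
  << fmu i >>.

Section Eval.
Variables (F : fieldType) (d : nat).

(** Polynomials are linear combinations of words, and a word arises from 1 by multiplying by letters
    on the left. *)
Lemma ncpoly_ind (Q : ncpoly F d -> Prop) :
  (forall c p q, Q p -> Q q -> Q (c *: p + q)) -> Q 0 -> Q 1 ->
  (forall i p, Q p -> Q (ncvar F i * p)) -> forall p, Q p.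
Proof.
move=> Qlin Q0 Q1 QM p; rewrite (monalgE p).
elim: (enum_fset (msupp p)) => [|m s IHs]; first by rewrite big_nil.
rewrite big_cons; set c := p@_m.
have -> : << c *g m >> = c *: (<< m >> : ncpoly F d).
  by rewrite -mul_malgC malgM_def fgmulUU mul1m mulr1.
apply: Qlin => //.
case: m {c} => m; elim: m => [|i m IHm].
  by have -> : << FMonom [::] >> = 1 :> ncpoly F d by rewrite -fmoneE.
have -> : << FMonom (i :: m) >> = ncvar F i * << FMonom m >> :> ncpoly F d.
  rewrite [RHS]malgM_def fgmulUU mulr1.
  by congr mkmalgU; rewrite /mmul /= fmmulE fmuE.
exact: QM.
Qed.

Variables (S : algType F) (a : 'I_d -> S).

Let ev (m : {fmonom 'I_d}) : S := \prod_(i <- m) a i.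

Let ev_mmorphism : mmorphism ev.
Proof.
by split=> [m n|]; rewrite /ev ?fmM ?big_cat // fm1 big_nil.
Qed.

HB.instance Definition _ := isMultiplicative.Build _ _ ev ev_mmorphism.

Lemma nceval_linear : linear (nceval a).
Proof.
rewrite -[nceval a]/(mmap (in_alg S) ev) => c p q.
rewrite raddfD; congr (_ + _).
transitivity (c%:A * mmap (in_alg S) ev p).
  exact: (@mmapZ _ _ _ (in_alg S) ev).
by rewrite -scalerAl mul1r.
Qed.

Lemma nceval_monoid : monoid_morphism (nceval a).
Proof.
have [|evM ev1] := @commr_mmap_is_multiplicative _ _ _ (in_alg S) ev.
  by move=> g m m'; rewrite /GRing.comm /= -scalerAl -scalerAr mul1r mulr1.
by split.
Qed.

End Eval.

HB.instance Definition _ F d S a :=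
  @GRing.isLinear.Build _ _ _ _ (nceval a) (@nceval_linear F d S a).
HB.instance Definition _ F d S a :=
  @GRing.isMonoidMorphism.Build _ _ (nceval a) (@nceval_monoid F d S a).

Section EvalTheory.
Variables (F : fieldType).

Lemma nceval_var d (S : algType F) (a : 'I_d -> S) i :
  nceval a (ncvar F i) = a i.
Proof.
rewrite /nceval /ncvar (_ : (fun c => _) = in_alg S) // mmapU /=.
by rewrite scale1r mul1r fmU big_seq1.
Qed.

Lemma ncevalB d (S : algType F) (a : 'I_d -> S) p q :
  nceval a (p - q) = nceval a p - nceval a q.
Proof. exact: raddfB. Qed.

Lemma ncevalM d (S : algType F) (a : 'I_d -> S) p q :
  nceval a (p * q) = nceval a p * nceval a q.
Proof. exact: rmorphM. Qed.

(* Stated for one rewriting step: rewriting with [ncevalM] compares distinct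
   products by conversion, which unfolds the algebra structure. *)
Lemma nceval_twist d (S : algType F) (a : 'I_d -> S) (b u v c : ncpoly F d) :
  nceval a (b * u - v * c) = nceval a b * nceval a u - nceval a v * nceval a c.
Proof. exact: (rmorph_twist (nceval a)). Qed.

Lemma nceval1 d (S : algType F) (a : 'I_d -> S) : nceval a 1 = 1.
Proof. exact: rmorph1. Qed.

Lemma lrmorph_ncpoly_eq d (S : algType F)
    (h h' : {lrmorphism ncpoly F d -> S}) :
  (forall i, h (ncvar F i) = h' (ncvar F i)) -> h =1 h'.
Proof.
move=> hh' p; elim/ncpoly_ind: p => [c p q IHp IHq|||i p IHp].
- by rewrite !linearP /= IHp IHq.
- by rewrite !linear0.
- by rewrite !rmorph1.
- by rewrite !rmorphM /= IHp hh'.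
Qed.

Lemma lrmorph_nceval d (S S' : algType F) (h : {lrmorphism S -> S'})
    (a : 'I_d -> S) p : h (nceval a p) = nceval (h \o a) p.
Proof.
apply: (lrmorph_ncpoly_eq (h := h \o nceval a)) => i /=.
by rewrite !nceval_var.
Qed.

Lemma eq_nceval d (S : algType F) (a b : 'I_d -> S) :
  a =1 b -> nceval a =1 nceval b.
Proof.
by move=> ab; apply: lrmorph_ncpoly_eq => i; rewrite /= !nceval_var.
Qed.

Lemma lrmorph_ncpoly d (S : algType F) (h : {lrmorphism ncpoly F d -> S}) p :
  h p = nceval (fun i => h (ncvar F i)) p.
Proof. by apply: lrmorph_ncpoly_eq => i; rewrite /= nceval_var. Qed.

(** Substitution is evaluation in the free algebra itself. The result type hides the alias [ncalg],
    so that later statements mention [ncpoly] only. *)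
Definition ncsubst d d' (x : 'I_d' -> ncpoly F d) (p : ncpoly F d') :
    ncpoly F d :=
  @nceval F (ncalg F d) d' x p.

Lemma lrmorph_ncsubst d d' (S : algType F) (h : {lrmorphism ncpoly F d -> S})
    (x : 'I_d' -> ncpoly F d) p : h (ncsubst x p) = nceval (fun i => h (x i)) p.
Proof. exact: (@lrmorph_nceval _ (ncalg F d) S h). Qed.

Lemma nceval_ncsubst d d' (S : algType F) (a : 'I_d -> S)
    (x : 'I_d' -> ncpoly F d) p :
  nceval a (ncsubst x p) = nceval (fun i => nceval a (x i)) p.
Proof. exact: (lrmorph_ncsubst (nceval a)). Qed.

Lemma ncsubst_ncsubst d d' d'' (x : 'I_d' -> ncpoly F d)
    (y : 'I_d'' -> ncpoly F d') p :
  ncsubst x (ncsubst y p) = ncsubst (fun i => ncsubst x (y i)) p.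
Proof. exact: (@nceval_ncsubst _ _ (ncalg F d)). Qed.

Lemma eq_ncsubst d d' (x y : 'I_d' -> ncpoly F d) :
  x =1 y -> ncsubst x =1 ncsubst y.
Proof. exact: (@eq_nceval _ (ncalg F d)). Qed.

Lemma ncsubst_var d d' (x : 'I_d' -> ncpoly F d) i :
  ncsubst x (ncvar F i) = x i.
Proof. exact: (@nceval_var _ (ncalg F d)). Qed.

Lemma ncsubst_vars d (p : ncpoly F d) : ncsubst (@ncvar F d) p = p.
Proof.
rewrite /ncsubst; symmetry; exact: (@lrmorph_ncpoly d (ncalg F d) idfun).
Qed.

Lemma ncsubst1 d d' (x : 'I_d' -> ncpoly F d) : ncsubst x 1 = 1.
Proof. exact: (@nceval1 _ (ncalg F d)). Qed.

Lemma ncsubst_lin d d' (x : 'I_d' -> ncpoly F d) c p q :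
  ncsubst x (c *: p + q) = c *: ncsubst x p + ncsubst x q.
Proof. exact: (@nceval_linear _ _ (ncalg F d)). Qed.

Lemma ncsubst0 d d' (x : 'I_d' -> ncpoly F d) : ncsubst x 0 = 0.
Proof. exact: (raddf0 (@nceval F (ncalg F d) d' x)). Qed.

Lemma ncsubstM d d' (x : 'I_d' -> ncpoly F d) p q :
  ncsubst x (p * q) = ncsubst x p * ncsubst x q.
Proof. exact: (@ncevalM _ (ncalg F d)). Qed.

Lemma ncsubst_sum d d' (x : 'I_d' -> ncpoly F d) (T : Type) (s : seq T)
    (p : T -> ncpoly F d') :
  ncsubst x (\sum_(t <- s) p t) = \sum_(t <- s) ncsubst x (p t).
Proof. exact: (raddf_sum (@nceval F (ncalg F d) d' x)). Qed.

(** The value at 0 in [F^o], the field as an algebra over itself, is the constant term of [p]. *)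
Lemma nceval0 d (S : algType F) (p : ncpoly F d) :
  nceval (fun=> 0 : S) p = (nceval (fun=> 0 : F^o) p)%:A.
Proof.
elim/ncpoly_ind: p => [c p q IHp IHq|||i p IHp].
- by rewrite !linearP /= IHp IHq scalerDl scalerA.
- by rewrite !linear0 scale0r.
- by rewrite !rmorph1 scale1r.
- by rewrite !rmorphM /= !nceval_var !mul0r scale0r.
Qed.

(** The constant [K] depends on [p] alone, not on the matrices or their sizes: it adds up under
    linear combinations and grows by one with each letter. *)
Lemma rank_nceval_intertwine d (p : ncpoly F d) :
  exists K : nat, forall (n n' k : nat) (A : 'I_d -> 'M[F]_n.+1)
    (B : 'I_d -> 'M[F]_n'.+1) (T : 'M[F]_(n'.+1, n.+1)),
    (forall i, \rank (B i *m T - T *m A i)%R <= k)%N ->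
    (\rank (nceval B p *m T - T *m nceval A p)%R <= K * k)%N.
Proof.
elim/ncpoly_ind: p => [c p q [K IHp] [K' IHq]|||i p [K IHp]].
- exists (K + K')%N => n n' k A B T AB.
  rewrite [nceval B _]linearP [nceval A _]linearP /= mulmxDl mulmxDr.
  rewrite -scalemxAl -scalemxAr opprD addrACA.
  rewrite -scalerBr mulnDl (leq_trans (mxrank_add _ _)) //.
  by rewrite leq_add ?IHq // (leq_trans (mxrank_scale _ _)) ?IHp.
- exists 0%N => n n' k A B T _.
  rewrite [nceval A _]linear0 [nceval B _]linear0 /= mul0mx mulmx0.
  by rewrite subr0 mxrank0.
- by exists 0%N => *; rewrite !rmorph1 mul1mx mulmx1 subrr mxrank0.
- exists (1 + K)%N => n n' k A B T AB.
  rewrite !rmorphM /= !nceval_var.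
  (* A Leibniz rule: [T] is moved past [nceval B p] first and past [B i] afterwards. *)
  have -> : B i * nceval B p *m T - T *m (A i * nceval A p) =
     B i *m (nceval B p *m T - T *m nceval A p)
      + (B i *m T - T *m A i) *m nceval A p.
    by rewrite mulmxBr mulmxBl !mulmxA addrA subrK.
  rewrite mulnDl addnC mul1n (leq_trans (mxrank_add _ _)) //.
  apply: leq_add.
    exact: leq_trans (mxrankM_maxr _ _) (IHp _ _ _ _ _ _ AB).
  exact: leq_trans (mxrankM_maxl _ _) (AB i).
Qed.

(** This is the rank estimate with [k = 0]. *)
Lemma nceval_intertwine d (p : ncpoly F d) n n' (A : 'I_d -> 'M[F]_n.+1)
    (B : 'I_d -> 'M[F]_n'.+1) (T : 'M[F]_(n'.+1, n.+1)) :
  (forall i, B i *m T = T *m A i) -> nceval B p *m T = T *m nceval A p.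
Proof.
move=> AB; have [K HK] := rank_nceval_intertwine p.
apply/eqP; rewrite -subr_eq0 -mxrank_eq0 -leqn0 -(muln0 K).
by apply: HK => i; rewrite AB subrr mxrank0.
Qed.

End EvalTheory.

(** * Ranks of matrices *)

(* [lia] does not abstract ranks of ring expressions by itself. *)
Ltac rank_lia :=
  intros;
  repeat match goal with
  | H : context [@mxrank _ _ _ _] |- _ => revert H
  end;
  repeat match goal with
  | |- context [@mxrank ?F ?m ?n ?X] => move: (@mxrank F m n X)
  end; intros; lia.

Section MatrixRank.
Variable F : fieldType.

Lemma mxrank_subl (m n : nat) (X Y : 'M[F]_(m, n)) :
  (\rank X <= \rank (X - Y)%R + \rank Y)%N.
Proof. by rewrite -{1}(subrK Y X) mxrank_add. Qed.

Lemma mxrank_subC (m n : nat) (X Y : 'M[F]_(m, n)) :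
  \rank (X - Y)%R = \rank (Y - X)%R.
Proof. by rewrite -opprB mxrank_opp. Qed.

Lemma mxrank_dist_trans (m n : nat) (Y X Z : 'M[F]_(m, n)) :
  (\rank (X - Z)%R <= \rank (X - Y)%R + \rank (Y - Z)%R)%N.
Proof. by rewrite -(subrKA Y) mxrank_add. Qed.

(** Gaussian elimination writes [D] as a partial identity between two invertible matrices;
    completing that partial identity costs exactly the corank. *)
Lemma near_unitmx (m : nat) (D : 'M[F]_m) :
  exists2 G : 'M[F]_m, G \in unitmx & (\rank (G - D)%R <= m - \rank D)%N.
Proof.
exists (col_ebase D *m row_ebase D).
  by rewrite unitmx_mul col_ebase_unit row_ebase_unit.
have -> : col_ebase D *m row_ebase D - D =
    col_ebase D *m copid_mx (\rank D) *m row_ebase D.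
  by rewrite mulmxBr mulmxBl mulmx1 mulmx_ebase.
apply: leq_trans (mxrankM_maxl _ _) _.
apply: leq_trans (mxrankM_maxr _ _) _.
by rewrite rank_copid_mx // rank_leq_row.
Qed.

(** The projection [e'] onto the eigenspace of [e] for 1 along the kernel of [e] agrees with [e] on
    the sum of the two spaces, so the rank of [e - e'] is at most the codimension of that sum. *)
Lemma idempotent_near (n : nat) (e : 'M[F]_n) :
  exists2 e' : 'M[F]_n, e' *m e' = e' &
    (\rank (e - e')%R <= \rank (e - e *m e)%R)%N.
Proof.
pose U := kermx (1%:M - e); pose V := kermx e.
have Ue : U *m e = U.
  by apply/eqP; rewrite eq_sym -subr_eq0 -{1}(mulmx1 U) -mulmxBr mulmx_ker.
have Ve : V *m e = 0 by rewrite mulmx_ker.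
have dUV : (U :&: V = 0)%MS.
  apply/eqP; rewrite -submx0.
  have : ((U :&: V)%MS *m e = (U :&: V)%MS).
    have /submxP[D ->] : (U :&: V <= U)%MS by rewrite capmxSl.
    by rewrite -mulmxA Ue.
  move=> <-; have /submxP[D ->] : (U :&: V <= V)%MS by rewrite capmxSr.
  by rewrite -mulmxA Ve mulmx0.
exists (proj_mx U V); first exact: proj_mx_proj.
have K : (U + V)%MS *m (e - proj_mx U V) = 0.
  apply/eqP; rewrite -submx0 addsmxMr addsmx_sub.
  by rewrite !mulmxBr proj_mx_id // proj_mx_0 // Ue Ve !subrr !sub0mx.
have := mulmx0_rank_max K.
have := mxrank_disjoint_sum dUV; rewrite !mxrank_ker => ->.
(* Sylvester's inequality bounds this codimension, which is [\rank (1 - e) + \rank e - n], by the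
   rank of [(1 - e) e]. *)
have := mxrank_mul_min (1%:M - e) e.
rewrite mulmxBl mul1mx.
have := rank_leq_row e; have := rank_leq_row (1%:M - e).
rank_lia.
Qed.

(** In a rank factorization [C *m R] of an idempotent, [C] can be cancelled on the left and [R] on
    the right of [C R C R = C R]. Compression to the corner of [e] is then [X] going to [R X C]. *)
Lemma idempotent_factor (n m : nat) (e : 'M[F]_n) : e *m e = e -> \rank e = m ->
  exists (C : 'M[F]_(n, m)) (R : 'M[F]_(m, n)), C *m R = e /\ R *m C = 1%:M.
Proof.
move=> ee <-.
have := mulmx_base e; have := row_base_free e; have := col_base_full e.
move: (col_base e) (row_base e) => C R fC fR CR; exists C, R; split=> //.
apply: (row_free_inj fR); apply: (row_full_inj fC).
by rewrite /= mul1mx !mulmxA CR -mulmxA CR.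
Qed.

(** With the number of rows as rank parameter, all [minn a b] diagonal entries are 1. Multiplication
    by these matrices pads by zeros or truncates. *)
Definition idmx (a b : nat) : 'M[F]_(a, b) := pid_mx a.

Lemma idmx1 (a : nat) : idmx a a = 1%:M.
Proof. exact: pid_mx_1. Qed.

(** Diagonal entries are lost only if the middle size is below both outer ones. *)
Lemma mul_idmx (a b c : nat) : (a <= b)%N || (c <= b)%N ->
  idmx a b *m idmx b c = idmx a c.
Proof.
move=> ab; rewrite /idmx mul_pid_mx; apply/matrixP=> i j; rewrite !mxE.
have := ltn_ord i; have := ltn_ord j.
case: eqP => //= <- ic ia; congr (_%:R); congr nat_of_bool; lia.
Qed.

Lemma rank_idmx (a b : nat) : \rank (idmx a b) = minn a b.
Proof.
by rewrite /idmx -pid_mx_minh rank_pid_mx ?geq_minl ?geq_minr 1?minnC.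
Qed.

Lemma rank_coidmx (a b : nat) :
  \rank (1%:M - idmx a b *m idmx b a)%R = (a - b)%N.
Proof. by rewrite /idmx mul_pid_mx rank_copid_mx; lia. Qed.

(** The matrix [D] takes [T] to the rectangular identity up to rank [k], since [pinvmx T *m T]
    differs from 1 by the corank of [T]. The corank of [D] is at most [2 * k], and making [D]
    invertible costs as much again. *)
Lemma near_idmx (n n' k : nat) (T : 'M[F]_(n', n)) :
  (n <= \rank T + k)%N -> (n' <= \rank T + k)%N ->
  exists2 h : 'M[F]_n', h \in unitmx &
    (\rank (h *m T - idmx n' n)%R <= 3 * k)%N.
Proof.
move=> nT n'T.
pose D := idmx n' n *m pinvmx T.
have TXT : T *m (1%:M - pinvmx T *m T) = 0.
  by rewrite mulmxBr mulmx1 mulmxA mulmxKpV ?subrr.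
have rX := mulmx0_rank_max TXT.
have DT : (\rank (D *m T - idmx n' n)%R <= k)%N.
  rewrite mxrank_subC -{1}[idmx n' n]mulmx1 -mulmxA -mulmxBr.
  by rewrite (leq_trans (mxrankM_maxr _ _)) //; move: rX; rank_lia.
have [G Gu GD] := near_unitmx D.
exists G => //.
have := mxrank_dist_trans (D *m T) (G *m T) (idmx n' n).
rewrite -mulmxBl; have := mxrankM_maxl (G - D) T.
have := mxrank_subl (idmx n' n) (D *m T); rewrite mxrank_subC rank_idmx.
have := mxrankM_maxl D T.
have := rank_leq_row T; have := rank_leq_col T.
rank_lia.
Qed.

Lemma hat_idmx (n N : nat) (A : 'M[F]_n) : (n <= N)%N ->
  \matrix_(i < N, j < N) hat A i j = idmx N n *m A *m idmx n N.
Proof.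
move=> nN; apply/matrixP => i j; rewrite !mxE /hat.
have left_id l : (idmx N n *m A) i l =
    if insub (i : nat) is Some i' then A i' l else 0.
  rewrite mxE; case: insubP => [i' _ def_i | n_i].
    rewrite (bigD1 i') //= mxE -def_i eqxx (leq_trans (ltn_ord i')) // mul1r.
    rewrite big1 ?addr0 // => k; rewrite mxE -val_eqE eq_sym -def_i /=.
    by move/negPf => ->; rewrite mul0r.
  rewrite big1 // => k _; rewrite mxE.
  by case: eqP => [ik|]; rewrite ?mul0r //; move: n_i; rewrite ik ltn_ord.
case: (insubP _ (j : nat)) => [j' _ def_j | n_j].
  rewrite (bigD1 j') //= left_id [idmx n N _ _]mxE -def_j eqxx ltn_ord mulr1.
  rewrite big1 ?addr0 ?def_j // => k.
  rewrite [idmx n N _ _]mxE -val_eqE /= def_j.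
  by move/negPf => ->; rewrite mulr0.
rewrite big1 => [|k _]; first by case: insubP.
rewrite [idmx n N _ _]mxE; case: eqP => [kj|]; rewrite ?mulr0 //.
by move: n_j; rewrite -kj ltn_ord.
Qed.

(** Every [a] by [b] window of the infinite difference, even one exceeding its support, comes from
    the supporting block by two multiplications. *)
Lemma rank_hatB_ge (n n' a b : nat) (A : 'M[F]_n) (B : 'M[F]_n') :
  (\rank (idmx a n' *m B *m idmx n' b - idmx a n *m A *m idmx n b)%R
     <= rank_hatB A B)%N.
Proof.
rewrite /rank_hatB; set N := maxn n n'.
have -> : \matrix_(i < N, j < N) (hat A i j - hat B i j) =
    idmx N n *m A *m idmx n N - idmx N n' *m B *m idmx n' N.
  rewrite -!hat_idmx ?leq_maxl ?leq_maxr //.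
  by apply/matrixP => i j; rewrite !mxE.
rewrite mxrank_subC; set X := (X in (_ <= \rank X)%N).
have -> : idmx a n *m A *m idmx n b - idmx a n' *m B *m idmx n' b =
    idmx a N *m X *m idmx N b.
  rewrite mulmxBr mulmxBl !mulmxA !mul_idmx ?leq_maxl ?leq_maxr ?orbT //.
  by rewrite -!mulmxA !mul_idmx ?leq_maxl ?leq_maxr ?orbT.
by rewrite (leq_trans (mxrankM_maxl _ _)) ?mxrankM_maxr.
Qed.

Lemma rank_hatB_le (n n' : nat) (A : 'M[F]_n) (B : 'M[F]_n') :
  (rank_hatB A B <= \rank (B *m idmx n' n - idmx n' n *m A)%R
     + ((n - n') + (n' - n)))%N.
Proof.
rewrite /rank_hatB; set N := maxn n n'.
have -> : \matrix_(i < N, j < N) (hat A i j - hat B i j) =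
    idmx N n *m A *m idmx n N - idmx N n' *m B *m idmx n' N.
  rewrite -!hat_idmx ?leq_maxl ?leq_maxr //.
  by apply/matrixP => i j; rewrite !mxE.
set X := _ - _.
pose P := idmx N n *m idmx n N; pose P' := idmx N n' *m idmx n' N.
(* The window of the first [n'] rows and [n] columns carries the intertwining error; the other
   columns and rows number [n' - n] and [n - n']. *)
have -> : X = P' *m X *m P + P' *m X *m (1%:M - P) + (1%:M - P') *m X.
  rewrite -mulmxDr [P + _]addrC subrK mulmx1 -mulmxDl [P' + _]addrC subrK.
  by rewrite mul1mx.
have PXP : (\rank (P' *m X *m P) <=
    \rank (B *m idmx n' n - idmx n' n *m A)%R)%N.
  have -> : P' *m X *m P =
      idmx N n' *m (idmx n' N *m X *m idmx N n) *m idmx n N.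
    by rewrite !mulmxA.
  rewrite (leq_trans (mxrankM_maxl _ _)) // (leq_trans (mxrankM_maxr _ _)) //.
  rewrite mulmxBr mulmxBl !mulmxA !mul_idmx ?leq_maxl ?leq_maxr ?orbT //.
  rewrite -!mulmxA !mul_idmx ?leq_maxl ?leq_maxr ?orbT // !idmx1 mul1mx mulmx1.
  by rewrite mxrank_subC.
have := mxrank_add (P' *m X *m P + P' *m X *m (1%:M - P)) ((1%:M - P') *m X).
have := mxrank_add (P' *m X *m P) (P' *m X *m (1%:M - P)).
have := mxrankM_maxr (P' *m X) (1%:M - P).
have := mxrankM_maxl (1%:M - P') X.
rewrite !rank_coidmx /N; rank_lia.
Qed.

End MatrixRank.

(** * A basis-free form of rank stability *)

Definition close (F : fieldType) (d n n' k : nat) (A : 'I_d -> 'M[F]_n)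
    (B : 'I_d -> 'M[F]_n') (T : 'M[F]_(n', n)) : Prop :=
  [/\ (n <= \rank T + k)%N, (n' <= \rank T + k)%N &
      forall i, (\rank (B i *m T - T *m A i)%R <= k)%N].

Definition approx_sol (F : fieldType) (d r p n : nat) (P : 'I_r -> ncpoly F d)
    (A : 'I_d -> 'M[F]_n.+1) : Prop :=
  forall i, (p * \rank (nceval A (P i)) <= n.+1)%N.

Definition exact_sol (F : fieldType) (d r n : nat) (P : 'I_r -> ncpoly F d)
    (A : 'I_d -> 'M[F]_n.+1) : Prop :=
  forall i, nceval A (P i) = 0.

Definition hat_stable (F : fieldType) (d r : nat) (P : 'I_r -> ncpoly F d) :=
  forall q : nat, exists2 p, (0 < p)%N &
    forall n (A : 'I_d -> 'M[F]_n.+1), approx_sol p P A ->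
    exists n' (B : 'I_d -> 'M[F]_n'.+1),
      exact_sol P B /\ forall i, (q * rank_hatB (A i) (B i) <= n.+1)%N.

(* Rank stability in a basis-free form, with the reciprocals of the natural
   numbers [q] and [p] in the role of epsilon and delta. *)
Definition sim_stable (F : fieldType) (d r : nat) (P : 'I_r -> ncpoly F d) :=
  forall q : nat, exists2 p, (0 < p)%N &
    forall n (A : 'I_d -> 'M[F]_n.+1), approx_sol p P A ->
    exists n' (B : 'I_d -> 'M[F]_n'.+1) T k,
      [/\ exact_sol P B, (q * k <= n.+1)%N & close k A B T].

Section Stability.
Variables (F : fieldType) (d r : nat) (P : 'I_r -> ncpoly F d).

Lemma rank_stable_hatP (R : realType) : rank_stable_rels R P <-> hat_stable P.
Proof.
split=> [st q | st eps eps0].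
  (* The successor keeps epsilon positive when [q] is 0. *)
  have [|delta delta0 Hd] := st (q.+1%:R^-1); first by rewrite invr_gt0.
  pose p := Num.bound delta^-1.
  have pd : delta^-1 < p%:R by apply: archi_boundP; rewrite invr_ge0 ltW.
  have p0 : (0 < p)%N by rewrite -(ltr_nat R) (lt_trans _ pd) ?invr_gt0.
  exists p => // n A approx; have [i|n' [B [Bex Bhat]]] := Hd n A.
    rewrite /normalized_rank ltr_pdivrMr // -ltr_pdivrMl //.
    have := approx i; rewrite -(ler_nat R) natrM => pA.
    have [->|rk0] := posnP (\rank (nceval A (P i))).
      by rewrite mulr0.
    by rewrite (lt_le_trans _ pA) // ltr_pM2r // ltr0n.
  exists n', B; split=> // i; have := Bhat i.
  rewrite mulrC ltr_pdivlMr // -natrM ltr_nat; lia.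
pose q := Num.bound eps^-1.
have qe : eps^-1 < q%:R by apply: archi_boundP; rewrite invr_ge0 ltW.
have q0 : (0 < q)%N by rewrite -(ltr_nat R) (lt_trans _ qe) ?invr_gt0.
have [p p0 Hp] := st q.
exists p%:R^-1 => [|n A approx]; first by rewrite invr_gt0 ltr0n.
have [i|n' [B [Bex Bhat]]] := Hp n A.
  have := approx i; rewrite /normalized_rank ltr_pdivrMr // mulrC.
  by rewrite ltr_pdivlMr ?ltr0n // -natrM ltr_nat mulnC => /ltnW.
exists n', B; split=> // i; have := Bhat i.
rewrite -(ler_nat R) natrM => qB.
apply: le_lt_trans (_ : q%:R^-1 * n.+1%:R < _).
  by rewrite ler_pdivlMl // ltr0n.
by rewrite ltr_pM2r // -(invrK eps) ltf_pV2 // posrE ?ltr0n ?invr_gt0.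
Qed.

Lemma sim_hat_stable : sim_stable P -> hat_stable P.
Proof.
(* The factor 8 is 3 + 1 + 3 for the three error terms of the conjugated solution below, plus 1 for
   the difference of the sizes. *)
move=> st q; have [p p0 Hp] := st (8 * q)%N; exists p => // n A approx.
have [n' [B [T [k [Bex qk [nT n'T BT]]]]]] := Hp n A approx.
have [h hu hT] := near_idmx nT n'T.
exists n', (fun i => h *m B i *m invmx h); split=> [i|i].
  apply: (can_inj (mulmxK hu)); rewrite mul0mx.
  rewrite (@nceval_intertwine _ _ _ _ _ B) ?Bex ?mulmx0 // => j.
  by rewrite mulmxKV.
apply: leq_trans qk; rewrite [(8 * q)%N]mulnC -mulnA leq_mul2l.
apply/orP; right.
apply: leq_trans (rank_hatB_le _ _) _.
set J := idmx _ _ _ in hT *; set B' := _ *m invmx h.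
have -> : B' *m J - J *m A i = B' *m (J - h *m T) + h *m (B i *m T - T *m A i)
    + (h *m T - J) *m A i.
  have B'h : B' *m h = h *m B i by rewrite mulmxKV.
  by rewrite !mulmxBr mulmxBl !mulmxA B'h !subrKA.
have := mxrank_add (B' *m (J - h *m T) + h *m (B i *m T - T *m A i))
   ((h *m T - J) *m A i).
have := mxrank_add (B' *m (J - h *m T)) (h *m (B i *m T - T *m A i)).
have := mxrankM_maxr B' (J - h *m T).
rewrite [in X in (_ <= X)%N -> _]mxrank_subC.
have := mxrankM_maxr h (B i *m T - T *m A i); have := BT i.
have := mxrankM_maxl (h *m T - J) (A i).
have := rank_leq_row T; have := rank_leq_col T.
rank_lia.
Qed.

End Stability.

(** * Zero padding, truncation and the control of matrix sizes *)

Section ZeroExtension.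
Variables (F : fieldType) (d n n' : nat) (A : 'I_d -> 'M[F]_n.+1).
Hypothesis nn' : (n <= n')%N.

Let J : 'M[F]_(n'.+1, n.+1) := idmx F n'.+1 n.+1.
Let J' : 'M[F]_(n.+1, n'.+1) := idmx F n.+1 n'.+1.

Definition zero_ext : 'I_d -> 'M[F]_n'.+1 := fun i => J *m A i *m J'.

Let J'J : J' *m J = 1%:M.
Proof. by rewrite mul_idmx ?idmx1 ?ltnS ?nn'. Qed.

Lemma zero_ext_idmx i : zero_ext i *m J = J *m A i.
Proof. by rewrite -mulmxA J'J mulmx1. Qed.

(** All generators vanish on the padded part, so [p] acts there by its constant term. *)
Lemma nceval_zero_ext_compl (p : ncpoly F d) :
  nceval zero_ext p *m (1%:M - J *m J') =
  nceval (fun=> 0 : F^o) p *: (1%:M - J *m J').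
Proof.
rewrite (@nceval_intertwine _ _ _ _ _ (fun=> 0)) => [|i].
  by rewrite nceval0 -scalemxAr mulmx1.
rewrite mulmx0 mulmxBr mulmx1 /zero_ext mulmxA -(mulmxA _ J' J) J'J.
by rewrite mulmx1 subrr.
Qed.

(** A relation with nonzero constant term thus detects the amount of padding by its rank. *)
Lemma rank_nceval_zero_ext (p : ncpoly F d) :
  nceval (fun=> 0 : F^o) p != 0 ->
  (n' - n <= \rank (nceval zero_ext p))%N.
Proof.
move=> c0; have := mxrank_scale_nz (1%:M - J *m J') c0.
by rewrite -nceval_zero_ext_compl rank_coidmx subSS => <-; apply: mxrankM_maxl.
Qed.

Lemma nceval_zero_ext_eq0 (p : ncpoly F d) :
  nceval (fun=> 0 : F^o) p = 0 -> nceval A p = 0 -> nceval zero_ext p = 0.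
Proof.
move=> c0 Ap; have := nceval_zero_ext_compl p.
rewrite c0 scale0r mulmxBr mulmx1.
by rewrite mulmxA (nceval_intertwine _ zero_ext_idmx) Ap mulmx0 mul0mx subr0.
Qed.

End ZeroExtension.

(** The span [U] of the first [n.+1] coordinate rows and of all rows of the differences contains the
    rows of every [B i]. It is therefore invariant, and [B] restricts to it. *)
Lemma truncate_sol (F : fieldType) (d n n' k : nat) (A : 'I_d -> 'M[F]_n.+1)
    (B : 'I_d -> 'M[F]_n'.+1) : (n <= n')%N ->
  (forall i, \rank (B i - zero_ext n' A i)%R <= k)%N ->
  exists u (C : 'I_d -> 'M[F]_u.+1) (R : 'M[F]_(u.+1, n'.+1)),
    [/\ forall i, C i *m R = R *m B i, row_free R,
      (u <= n + d * k)%N & (n.+1 <= \rank (R *m idmx F n'.+1 n.+1))%N].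
Proof.
move=> nn' BA.
pose J' := idmx F n.+1 n'.+1.
pose U := (J' + \sum_i (B i - zero_ext n' A i))%MS.
have BU i : (B i <= U)%MS.
  rewrite -(subrK (zero_ext n' A i) (B i)) addmx_sub //.
    exact: submx_trans (sumsmx_sup i _ (submx_refl _)) (addsmxSr _ _).
  exact: submx_trans (submxMl _ _) (addsmxSl _ _).
have rU : (\rank U <= n.+1 + d * k)%N.
  apply: leq_trans (mxrank_adds_leqif _ _) _.
  apply: leq_add; first exact: rank_leq_row.
  apply: leq_trans (mxrank_sum_leqif _) _.
  apply: leq_trans (_ : \sum_(i < d) k <= _)%N.
    by apply: leq_sum => i _; apply: BA.
  by rewrite sum_nat_const card_ord.
have JU : (J' <= U)%MS by apply: addsmxSl.
have [R fR RU] : exists2 R : 'M[F]_(\rank U, n'.+1), row_free R & (R :=: U)%MS.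
  by exists (row_base U); [apply: row_base_free | apply: eq_row_base].
have rk0 : (n.+1 <= \rank (R *m idmx F n'.+1 n.+1))%N.
  have /submxP[D DR] : (J' <= R)%MS by rewrite RU.
  apply: leq_trans (mxrankM_maxr D _).
  by rewrite mulmxA -DR mul_idmx ?idmx1 ?mxrank1 // ltnS nn'.
move: rU R fR RU rk0; case: (\rank U) => [|u] rU R fR RU rk0.
  by have := leq_trans rk0 (rank_leq_row _).
exists u, (fun i => R *m B i *m pinvmx R), R; split=> // i.
by rewrite mulmxKpV // RU (submx_trans (submxMl _ _)).
Qed.

Section HatSim.
Variables (F : fieldType) (d r : nat) (P : 'I_r -> ncpoly F d).

Let hat_dist n n' (A : 'I_d -> 'M[F]_n) (B : 'I_d -> 'M[F]_n') :=
  \max_i rank_hatB (A i) (B i).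

Let hat_distP n n' (A : 'I_d -> 'M[F]_n) (B : 'I_d -> 'M[F]_n') i :
  (rank_hatB (A i) (B i) <= hat_dist A B)%N.
Proof. exact: (leq_bigmax i). Qed.

Let idmx_dist n n' (A : 'I_d -> 'M[F]_n) (B : 'I_d -> 'M[F]_n') i :
  (\rank (B i *m idmx F n' n - idmx F n' n *m A i)%R <= hat_dist A B)%N.
Proof.
apply: leq_trans (hat_distP A B i).
have := rank_hatB_ge n' n (A i) (B i).
by rewrite !idmx1 mul1mx mulmx1.
Qed.

Let zero_ext_dist n n' (A : 'I_d -> 'M[F]_n.+1) (B : 'I_d -> 'M[F]_n'.+1) i :
  (\rank (B i - zero_ext n' A i)%R <= hat_dist A B)%N.
Proof.
apply: leq_trans (hat_distP A B i).
have := rank_hatB_ge n'.+1 n'.+1 (A i) (B i).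
by rewrite !idmx1 mul1mx mulmx1.
Qed.

Let zero_ext_dist_sym n n' (A : 'I_d -> 'M[F]_n.+1)
    (B : 'I_d -> 'M[F]_n'.+1) i :
  (\rank (zero_ext n B i - A i)%R <= hat_dist A B)%N.
Proof.
apply: leq_trans (hat_distP A B i).
have := rank_hatB_ge n.+1 n.+1 (A i) (B i).
by rewrite !idmx1 mul1mx mulmx1.
Qed.

Let hat_dist_le q n n' (A : 'I_d -> 'M[F]_n.+1) (B : 'I_d -> 'M[F]_n') :
  (forall i, (q * rank_hatB (A i) (B i) <= n.+1)%N) ->
  (q * hat_dist A B <= n.+1)%N.
Proof.
move=> qAB; rewrite /hat_dist.
by elim/big_ind: _ => [|x y|i _]; rewrite ?muln0 // maxnMr geq_max => -> ->.
Qed.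

Let intertwine1 n k (A B : 'I_d -> 'M[F]_n.+1) :
  (forall i, (\rank (B i - A i)%R <= k)%N) ->
  forall i, (\rank (B i *m 1%:M - 1%:M *m A i)%R <= k)%N.
Proof. by move=> AB i; rewrite mulmx1 mul1mx. Qed.

(** Closeness of the hats says nothing about the sizes when [B] is much larger, for instance by a
    summand of small rank. Either a nonzero constant term bounds the difference of the sizes, or the
    zero tuple satisfies the relations and [B] can be padded or truncated. *)
Lemma hat_sim_stable : hat_stable P -> sim_stable P.
Proof.
move=> st q.
have [/existsP[i0 c0]|/existsPn c0] :=
    boolP [exists i, nceval (fun=> 0 : F^o) (P i) != 0].
  have [K HK] := rank_nceval_intertwine (P i0).
  have [p p0 Hp] := st (2 * q * K.+1)%N.
  exists (p + 2 * q)%N => [|n A approx]; first by rewrite addn_gt0 p0.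
  have [i|n' [B [Bex /hat_dist_le Bhat]]] := Hp n A.
    by apply: leq_trans (approx i); rewrite leq_mul2r leq_addr orbT.
  have approx0 := approx i0.
  set kh := hat_dist A B in Bhat.
  (* The smaller tuple is padded. Its padding violates [P i0] in rank at least the difference of the
     sizes, while the other tuple satisfies [P i0] exactly or approximately. *)
  have dims : (n - n' <= K * kh + \rank (nceval A (P i0)))%N
      /\ (n' - n <= K * kh)%N.
    case: (leqP n n') => [nn' | /ltnW n'n]; split; try lia.
      have := rank_nceval_zero_ext A nn' c0.
      have := HK _ _ _ _ _ _ (intertwine1 (zero_ext_dist A B)).
      by rewrite Bex mul0mx sub0r mul1mx mxrank_opp => le1 /leq_trans; apply.
    have := rank_nceval_zero_ext B n'n c0.
    have := HK _ _ _ _ _ _ (intertwine1 (zero_ext_dist_sym A B)).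
    rewrite mulmx1 mul1mx.
    have := mxrank_subl (nceval (zero_ext n B) (P i0)) (nceval A (P i0)).
    rewrite -/kh; rank_lia.
  exists n', B, (idmx F n'.+1 n.+1), (K.+1 * kh + \rank (nceval A (P i0)))%N.
  split=> //.
    move: Bhat approx0; move: (mxrank _) => rk; nia.
  case: dims => d1 d2; split=> [||i].
  - by rewrite rank_idmx; move: d1 d2; move: (mxrank _) => rk; nia.
  - by rewrite rank_idmx; move: d1 d2; move: (mxrank _) => rk; nia.
  - apply: leq_trans (idmx_dist A B i) _.
    by rewrite mulSn -addnA leq_addr.
(* Here all constant terms vanish. The factor [d.+1] pays for the truncated solution, whose size
   exceeds that of [A] by at most [d * kh]. *)
have [p p0 Hp] := st (q * d.+1)%N.
exists p => // n A approx.
have [n' [B [Bex /hat_dist_le Bhat]]] := Hp n A approx.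
set kh := hat_dist A B in Bhat.
have {}c0 i : nceval (fun=> 0 : F^o) (P i) = 0.
  by apply/eqP; rewrite -[_ == _]negbK c0.
case: (leqP n' n) => [n'n | /ltnW nn'].
  exists n, (zero_ext n B), 1%:M, kh; split.
  - by move=> i; apply: nceval_zero_ext_eq0.
  - by apply: leq_trans Bhat; nia.
  - split; rewrite ?mxrank1 ?leq_addr //.
    exact: intertwine1 (zero_ext_dist_sym A B).
have [u [C [R [CR fR ru rR]]]] := truncate_sol nn' (zero_ext_dist A B).
exists u, C, (R *m idmx F n'.+1 n.+1), (d.+1 * kh)%N; split.
- move=> i; apply: (row_free_inj fR).
  by rewrite /= (nceval_intertwine _ CR) Bex mulmx0 mul0mx.
- by rewrite mulnA.
- split.
  + exact: leq_trans rR (leq_addr _ _).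
  + by move: rR ru; rewrite -/kh; move: (mxrank _) => rk; nia.
  + move=> i; rewrite mulmxA CR -!mulmxA -mulmxBr.
    apply: leq_trans (mxrankM_maxr _ _) _.
    by apply: leq_trans (idmx_dist A B i) _; rewrite mulSn leq_addr.
Qed.

End HatSim.

(** * Quotients by a central idempotent *)

Lemma intertwine_mul (S : pzRingType) (b q u a p : S) :
  b * q * u - u * (a * p) = b * (q * u - u * p) + (b * u - u * a) * p.
Proof. by rewrite mulrBr mulrBl !mulrA subrKA. Qed.

Section Ideal.
Variables (F : fieldType) (d r : nat) (P : 'I_r -> ncpoly F d).
Local Notation I := (in_ideal P).

Lemma in_ideal_gen i : I (P i).
Proof. by exists [:: (1, i, 1)]; rewrite big_seq1 mul1r mulr1. Qed.

Lemma in_ideal0 : I 0.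
Proof. by exists [::]; rewrite big_nil. Qed.

Lemma in_idealD p q : I p -> I q -> I (p + q).
Proof. by move=> [s ->] [t ->]; exists (s ++ t); rewrite big_cat. Qed.

Lemma in_idealMl u p : I p -> I (u * p).
Proof.
move=> [s ->]; exists [seq (u * t.1.1, t.1.2, t.2) | t <- s].
by rewrite big_map mulr_sumr; apply: eq_bigr => t _; rewrite !mulrA.
Qed.

Lemma in_idealMr u p : I p -> I (p * u).
Proof.
move=> [s ->]; exists [seq (t.1.1, t.1.2, t.2 * u) | t <- s].
rewrite big_map mulr_suml; apply: eq_bigr => t _; exact/esym/mulrA.
Qed.

Lemma in_idealN p : I p -> I (- p).
Proof. by move=> /(in_idealMl (-1)); rewrite mulN1r. Qed.

Lemma in_idealB p q : I p -> I q -> I (p - q).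
Proof. by move=> Ip /in_idealN; apply: in_idealD. Qed.

Lemma in_idealZ c p : I p -> I (c *: p).
Proof. by move=> /(in_idealMl (c *: 1)); rewrite -scalerAl mul1r. Qed.

Lemma lrmorph_ideal_eq0 (S : algType F) (h : {lrmorphism ncpoly F d -> S}) p :
  (forall i, h (P i) = 0) -> I p -> h p = 0.
Proof.
move=> hP [s ->]; rewrite raddf_sum /= big1 // => t _.
by rewrite !rmorphM /= hP mulr0 mul0r.
Qed.

(** This is the counterpart of [rank_nceval_intertwine] with small rank replaced by membership in
    the ideal. *)
Lemma in_ideal_intertwine d' (a b : 'I_d' -> ncpoly F d) (u : ncpoly F d) :
  (forall i, I (b i * u - u * a i)) ->
  forall p, I (ncsubst b p * u - u * ncsubst a p).
Proof.
move=> ab p; elim/ncpoly_ind: p => [c p q IHp IHq|||i p IHp].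
- rewrite !ncsubst_lin mulrDl mulrDr opprD addrACA -scalerAl -ncpoly_scalerAr.
  by rewrite -scalerBr; exact (in_idealD (in_idealZ c IHp) IHq).
- by rewrite !ncsubst0 mulr0 mul0r subrr; apply: in_ideal0.
- by rewrite !ncsubst1 mulr1 mul1r subrr; apply: in_ideal0.
- rewrite !ncsubstM !ncsubst_var intertwine_mul.
  exact (in_idealD (in_idealMl (b i) IHp) (in_idealMr (ncsubst a p) (ab i))).
Qed.

End Ideal.

Definition fcase (T : Type) (m n : nat) (f : 'I_m -> T) (g : 'I_n -> T)
    (i : 'I_(m + n)) : T :=
  match split i with inl a => f a | inr b => g b end.

Section Fcase.
Variables (T : Type) (m n : nat) (f : 'I_m -> T) (g : 'I_n -> T).

Lemma fcase_lshift a : fcase f g (lshift n a) = f a.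
Proof. by rewrite /fcase (unsplitK (inl a)). Qed.

Lemma fcase_rshift b : fcase f g (rshift m b) = g b.
Proof. by rewrite /fcase (unsplitK (inr b)). Qed.

Lemma forall_split (Q : 'I_(m + n) -> Prop) :
  (forall a, Q (lshift n a)) -> (forall b, Q (rshift m b)) -> forall i, Q i.
Proof. by move=> Ql Qr i; case: (split_ordP i) => j ->. Qed.

End Fcase.

Lemma rank_stable_simP (R : realType) (F : fieldType) (d r : nat)
    (P : 'I_r -> ncpoly F d) : rank_stable_rels R P <-> sim_stable P.
Proof.
rewrite rank_stable_hatP.
by split; [apply: hat_sim_stable | apply: sim_hat_stable].
Qed.

Section CentralQuotient.
Variables (F : fieldType) (B A : algType F) (g : {lrmorphism B -> A}) (e : B).
Hypotheses (g_surj : forall a, exists b, g b = a) (e_idem : e * e = e)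
  (e_central : forall b, e * b = b * e)
  (g_ker : forall b, g b = 0 <-> e * b = 0).

Variables (d r : nat) (Q : 'I_r -> ncpoly F d).
Variable f : {lrmorphism ncpoly F d -> B}.
Hypotheses (f_surj : forall b, exists p, f p = b)
  (f_ker : forall p, f p = 0 <-> in_ideal Q p).
Variables (E : ncpoly F d) (fE : f E = e).

(** The kernel of [g] is the annihilator of the central idempotent [e], that is, the ideal generated
    by [1 - e]. *)
Definition quot_rels : 'I_(r + 1) -> ncpoly F d := fcase Q (fun=> 1 - E).

(** In [p = E p + (1 - E) p] the second term is killed by the new relation, and the first lies in
    the old ideal as soon as [p] vanishes in [A]. *)
Lemma presents_quot : presents quot_rels A.
Proof.
exists (g \o f); split=> [a | p].
  by have [b <-] := g_surj a; have [p <-] := f_surj b; exists p.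
have QI q : in_ideal Q q -> in_ideal quot_rels q.
  case=> s ->; exists [seq (t.1.1, lshift 1 t.1.2, t.2) | t <- s].
  by rewrite big_map; apply: eq_bigr => t _; rewrite /quot_rels fcase_lshift.
split=> /= [/g_ker ep0|].
  have -> : p = E * p + (1 - E) * p by rewrite mulrBl mul1r addrC subrK.
  apply: in_idealD.
    by apply: QI; apply/f_ker; rewrite rmorphM /= fE.
  apply: in_idealMr; have := in_ideal_gen quot_rels (rshift r ord0).
  by rewrite {2}/quot_rels fcase_rshift.
apply: (lrmorph_ideal_eq0 (h := g \o f)); apply: forall_split => i /=.
  rewrite /quot_rels fcase_lshift (_ : f (Q i) = 0) ?rmorph0 //.
  by apply/f_ker; apply: in_ideal_gen.
rewrite /quot_rels fcase_rshift; apply/g_ker.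
by rewrite rmorphB rmorph1 /= fE mulrBr mulr1 e_idem subrr.
Qed.

Lemma sim_stable_quot : sim_stable Q -> sim_stable quot_rels.
Proof.
move=> st q; have [K HK] := rank_nceval_intertwine E.
(* The factor 2 shares the error between [k] and the defect [s] of [1 - E]. Using [q.+2] keeps
   [K.+1 * k + s] at most half of [n.+1], whence the corner found below is nonzero even for
   [q = 0]. *)
have [p p0 Hp] := st (2 * q.+2 * K.+1)%N.
exists (p + 2 * q.+2)%N => [|n Z approx]; first by rewrite addn_gt0 p0.
have [i|n' [W [T [k [Wex qk [nT n'T WT]]]]]] := Hp n Z.
  have := approx (lshift 1 i); rewrite /quot_rels fcase_lshift.
  apply: leq_trans.
  by rewrite leq_mul2r leq_addr orbT.
have := approx (rshift r ord0).
rewrite {1}/quot_rels fcase_rshift ncevalB nceval1.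
have [s es] : exists s, \rank (1 - nceval Z E) = s by eexists.
rewrite es => ps.
pose eW := nceval W E.
(* The exact solution [W] is a representation of [B], so [eW] is exactly idempotent and central. *)
have ideal_W u : f u = 0 -> nceval W u = 0.
  by move=> /f_ker; apply: (lrmorph_ideal_eq0 (h := nceval W)).
have eWeW : eW *m eW = eW.
  apply/eqP; rewrite -subr_eq0; apply/eqP.
  have := ideal_W (E * E - E); rewrite ncevalB ncevalM.
  by apply; rewrite rmorphB rmorphM /= fE e_idem subrr.
have eWC i : eW *m W i = W i *m eW.
  apply/eqP; rewrite -subr_eq0; apply/eqP.
  have := ideal_W (E * ncvar F i - ncvar F i * E).
  rewrite nceval_twist nceval_var; apply.
  by rewrite rmorph_twist /= fE e_central subrr.
have eT : (\rank (eW *m T - T)%R <= K * k + s)%N.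
  have -> : eW *m T - T = (eW *m T - T *m nceval Z E) - T *m (1 - nceval Z E).
    by rewrite mulmxBr mulmx1 opprB subrKA.
  apply: leq_trans (mxrank_add _ _) _; rewrite mxrank_opp.
  by apply: leq_add; [exact: HK | rewrite -es; exact: mxrankM_maxr].
have [m em] : exists m, \rank eW = m by eexists.
have [C [R [CR RC]]] := idempotent_factor eWeW em.
have ReW : R *m eW = R by rewrite -CR mulmxA RC mul1mx.
have rRT : (\rank T <= \rank (R *m T) + (K * k + s))%N.
  have := mxrank_subl T (eW *m T); rewrite mxrank_subC -{2}CR -mulmxA.
  have := mxrankM_maxr C (R *m T); rank_lia.
have rRm := rank_leq_row (R *m T).
have m_le : (m <= n'.+1)%N by rewrite -em rank_leq_row.
have m0 : (0 < m)%N.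
  move: nT rRT rRm qk ps; move: (\rank T) (\rank (R *m T)).
  by move=> t rt; nia.
case: m m0 {em} C R CR RC ReW rRT rRm m_le => // m _ C R CR RC ReW rRT rRm m_le.
(* As [eW] commutes with [W i], compression to its image is intertwined exactly by [R]. *)
have CW i : R *m W i *m C *m R = R *m W i.
  by rewrite -!mulmxA CR -eWC mulmxA ReW.
exists m, (fun i => R *m W i *m C), (R *m T), (K.+1 * k + s)%N; split.
- move=> i; have := nceval_intertwine (quot_rels i) CW.
  suff -> : R *m nceval W (quot_rels i) = 0.
    by move/(congr1 (mulmx^~ C)); rewrite -mulmxA RC mulmx1 mul0mx.
  move: i; apply: forall_split => i; rewrite /quot_rels.
    by rewrite fcase_lshift Wex mulmx0.
  rewrite fcase_rshift ncevalB nceval1.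
  by rewrite mulmxBr mulmx1 ReW subrr.
- by move: qk ps; clear; nia.
- split.
  + move: nT rRT; rank_lia.
  + move: n'T rRT m_le; rank_lia.
  + move=> i; rewrite mulmxA CW -!mulmxA -mulmxBr.
    apply: leq_trans (mxrankM_maxr _ _) (leq_trans (WT i) _).
    by rewrite mulSn -addnA leq_addr.
Qed.

End CentralQuotient.

(** Stability asks for one suitable presentation, so that of [A] may be derived from the one given
    for [B]. *)
Lemma rank_stable_quotient (R : realType) (F : fieldType) (B A : algType F)
    (g : {lrmorphism B -> A}) (e : B) :
  (forall a, exists b, g b = a) -> e * e = e -> (forall b, e * b = b * e) ->
  (forall b, g b = 0 <-> e * b = 0) -> rank_stable R B -> rank_stable R A.
Proof.
move=> g_surj ee eC g_ker [d [r [Q [[f [f_surj f_ker]] st]]]].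
have [E fE] := f_surj e.
exists d, (r + 1)%N, (quot_rels Q E); split.
  exact: presents_quot fE.
by apply/rank_stable_simP/(sim_stable_quot ee eC f_ker fE)/rank_stable_simP/st.
Qed.

(** * Corners of approximate solutions *)

Lemma rank_nceval_intertwine_fin (F : fieldType) (d r : nat)
    (P : 'I_r -> ncpoly F d) :
  exists K : nat, forall i (n n' k : nat) (A : 'I_d -> 'M[F]_n.+1)
    (B : 'I_d -> 'M[F]_n'.+1) (T : 'M[F]_(n'.+1, n.+1)),
    (forall j, \rank (B j *m T - T *m A j)%R <= k)%N ->
    (\rank (nceval B (P i) *m T - T *m nceval A (P i))%R <= K * k)%N.
Proof.
have [K HK] := fin_all_exists (fun i => rank_nceval_intertwine (P i)).
exists (\max_i K i) => i n n' k A B T AB.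
by apply: leq_trans (HK i _ _ _ _ _ _ AB) _; rewrite leq_mul2r leq_bigmax orbT.
Qed.

(** The compression of [A] to the corner of [e'] is an approximate solution. Its errors are measured
    relative to the corner, so stability applies only when the corner has more than a fraction [1/q]
    of the full size; otherwise [B0] with [T = 0] is close enough. *)
Lemma corner_sol (F : fieldType) (d r : nat) (P : 'I_r -> ncpoly F d) m0
    (B0 : 'I_d -> 'M[F]_m0.+1) :
  sim_stable P -> exact_sol P B0 -> forall q, exists p N, forall n s
    (A : 'I_d -> 'M[F]_n.+1) (e e' : 'M[F]_n.+1),
    e' *m e' = e' -> (N <= n.+1)%N -> (p * s <= n.+1)%N ->
    (\rank (e - e')%R <= s)%N ->
    (forall i, \rank (A i *m e - e *m A i)%R <= s)%N ->
    (forall i, \rank (nceval A (P i) *m e) <= s)%N ->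
    exists m (B : 'I_d -> 'M[F]_m.+1) (T : 'M[F]_(m.+1, n.+1)) k,
      [/\ exact_sol P B, T *m e' = T, (q * k <= n.+1)%N,
          (\rank e' <= \rank T + k)%N /\ (m.+1 <= \rank T + k)%N &
          forall i, (\rank (B i *m T - T *m A i)%R <= k)%N].
Proof.
move=> st B0ex q; have [pA pA0 Hst] := st (2 * q)%N.
have [K HK] := rank_nceval_intertwine_fin P.
(* The compression violates the relations in rank at most [(3 * K + 2) * s], and [q] converts from
   the corner to the full size. The term [6 * q] absorbs the [3 * s] in the final distance, and the
   second witness makes the size of [B0] negligible. *)
exists (pA * (3 * K + 2) * q + 6 * q)%N, (q * m0.+1)%N.
move=> n s A e e' e'e' Nn ps ee' Ae PAe.
have [m em] : exists m, \rank e' = m by eexists.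
have [small|large] := leqP (q * m)%N n.+1.
  exists m0, B0, 0, (maxn m m0.+1); rewrite mul0mx em mxrank0; split=> //.
  - by rewrite maxnMr geq_max small Nn.
  - by rewrite !add0n leq_maxl leq_maxr.
  - by move=> i; rewrite mulmx0 mul0mx subrr mxrank0.
have [C [R [CR RC]]] := idempotent_factor e'e' em.
have Re' : R *m e' = R by rewrite -CR mulmxA RC mul1mx.
have corner i : (\rank (R *m A i - R *m A i *m e')%R <= 3 * s)%N.
  (* Exchange [e'] for [e], commute [e] past [A i] and exchange back: each of the three moves costs
     [s]. *)
  have -> : R *m A i - R *m A i *m e' = R *m A i *m (e - e')
      + R *m (e *m A i - A i *m e) + R *m (e' - e) *m A i.
    rewrite !mulmxBr !mulmxBl Re' !mulmxA.
    move: (R *m A i *m e) (R *m e *m A i) => x y.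
    by rewrite [RHS]addrC [x - _ + _]addrC !subrKA.
  apply: leq_trans (mxrank_add _ _) _.
  have := mxrank_add (R *m A i *m (e - e')) (R *m (e *m A i - A i *m e)).
  have := mxrankM_maxr (R *m A i) (e - e').
  have := mxrankM_maxr R (e *m A i - A i *m e).
  have := mxrankM_maxl (R *m (e' - e)) (A i).
  have := mxrankM_maxr R (e' - e).
  rewrite [\rank (e' - e)%R]mxrank_subC [\rank (e *m A i - _)%R]mxrank_subC.
  move: ee' (Ae i); rank_lia.
case: m {em} R C CR RC Re' corner large => [|m] R C CR RC Re' corner large.
  by rewrite muln0 in large.
pose X i := R *m A i *m C.
have XR i : (\rank (X i *m R - R *m A i)%R <= 3 * s)%N.
  by rewrite mxrank_subC -mulmxA CR.
have PX i : (\rank (nceval X (P i)) <= K * (3 * s) + 2 * s)%N.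
  (* Since [e' C = C], the value of [P i] may be multiplied by [e'], which is then exchanged for [e]
     to use the hypothesis on [P i]. *)
  have -> : nceval X (P i) =
      (nceval X (P i) *m R - R *m nceval A (P i)) *m C
      + (R *m nceval A (P i) *m (e' - e) *m C
         + R *m (nceval A (P i) *m e) *m C).
    rewrite !mulmxBr !mulmxBl -!mulmxA RC mulmx1.
    have -> : e' *m C = C by rewrite -CR -mulmxA RC mulmx1.
    by rewrite !subrK.
  apply: leq_trans (mxrank_add _ _) _; apply: leq_add.
    exact: leq_trans (mxrankM_maxl _ _) (HK _ _ _ _ _ _ _ XR).
  apply: leq_trans (mxrank_add _ _) _; rewrite mul2n -addnn; apply: leq_add.
    apply: leq_trans (mxrankM_maxl _ _) _.
    apply: leq_trans (mxrankM_maxr _ _) _.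
    by rewrite mxrank_subC.
  apply: leq_trans (mxrankM_maxl _ _) _; apply: leq_trans (mxrankM_maxr _ _) _.
  exact: PAe.
have [i|m' [B [T [k [Bex qk [mT m'T BT]]]]]] := Hst m X.
  have : (q * (pA * ((3 * K + 2) * s)) < q * m.+1)%N.
    by move: ps large; clear; nia.
  rewrite ltn_mul2l => /andP[_ /ltnW]; apply: leq_trans.
  by rewrite leq_mul2l; apply/orP; right; apply: leq_trans (PX i) _; lia.
have rTR : \rank (T *m R) = \rank T.
  apply/eqP; rewrite eqn_leq mxrankM_maxl -{1}(mulmx1 T) -RC mulmxA.
  exact: mxrankM_maxl.
have m_le : (m.+1 <= n.+1)%N.
  by rewrite -(mxrank1 F m.+1) -RC (leq_trans (mxrankM_maxl _ _)) ?rank_leq_col.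
exists m', B, (T *m R), (k + 3 * s)%N; rewrite rTR; split.
- exact: Bex.
- by rewrite -mulmxA Re'.
- by move: qk ps m_le; clear; nia.
- split; last by move: m'T; rank_lia.
  have : (\rank e' <= m.+1)%N.
    by rewrite -CR (leq_trans (mxrankM_maxl _ _)) ?rank_leq_col.
  move: mT; rank_lia.
- move=> i.
  have -> : B i *m (T *m R) - T *m R *m A i =
      (B i *m T - T *m X i) *m R + T *m (X i *m R - R *m A i).
    by rewrite mulmxBr mulmxBl !mulmxA subrKA.
  apply: leq_trans (mxrank_add _ _) _; apply: leq_add.
    exact: leq_trans (mxrankM_maxl _ _) (BT i).
  exact: leq_trans (mxrankM_maxr _ _) (XR i).
Qed.

(** * Presentation of a product *)

Lemma commute_last (S : pzRingType) (a p b u : S) :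
  a * p * b * u = a * p * (b * u - u * b) + a * (p * u) * b.
Proof. by rewrite mulrBr !mulrA subrK. Qed.

Section Gens.
Variables (d d' : nat).

Definition gens (S : Type) (e : S) (x : 'I_d -> S) (y : 'I_d' -> S) :
    'I_(d + d' + 1) -> S :=
  fcase (fcase x y) (fun=> e).

Definition ge : 'I_(d + d' + 1) := rshift (d + d') ord0.
Definition gx (i : 'I_d) : 'I_(d + d' + 1) := lshift 1 (lshift d' i).
Definition gy (j : 'I_d') : 'I_(d + d' + 1) := lshift 1 (rshift d j).

Lemma gens_ge S (e : S) x y : gens e x y ge = e.
Proof. by rewrite /gens fcase_rshift. Qed.

Lemma gens_gx S (e : S) x y i : gens e x y (gx i) = x i.
Proof. by rewrite /gens !fcase_lshift. Qed.

Lemma gens_gy S (e : S) x y j : gens e x y (gy j) = y j.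
Proof. by rewrite /gens fcase_lshift fcase_rshift. Qed.

Definition gensE := (gens_ge, gens_gx, gens_gy).

Lemma gens_ind (Q : 'I_(d + d' + 1) -> Prop) :
  Q ge -> (forall i, Q (gx i)) -> (forall j, Q (gy j)) -> forall g, Q g.
Proof.
move=> Qe Qx Qy; apply: forall_split => [|i]; last by rewrite [i]ord1.
exact: forall_split.
Qed.

Lemma gens_map S S' (h : S -> S') e x y g :
  h (gens e x y g) = gens (h e) (h \o x) (h \o y) g.
Proof. by elim/gens_ind: g => [|i|j]; rewrite !gensE. Qed.

Lemma eq_gens S (e : S) x x' y y' : x =1 x' -> y =1 y' ->
  gens e x y =1 gens e x' y'.
Proof. by move=> xx' yy'; apply: gens_ind => *; rewrite !gensE. Qed.

End Gens.

Arguments gx {d} d' i.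
Arguments gy d {d'} j.

Section ProductRels.
Variables (F : fieldType) (d d' r r' : nat).
Variables (P : 'I_r -> ncpoly F d) (P' : 'I_r' -> ncpoly F d').

Local Notation D := (d + d' + 1)%N.
Let vE : ncpoly F D := ncvar F (ge d d').
Let vx (i : 'I_d) : ncpoly F D := ncvar F (gx d' i).
Let vy (j : 'I_d') : ncpoly F D := ncvar F (gy d j).

Let left_gen (g : 'I_D) : ncpoly F D := gens 1 vx (fun=> 0) g.
Let right_gen (g : 'I_D) : ncpoly F D := gens 0 (fun=> 0) vy g.

(** In the corner of [e] the generators [e], [x_i], [y_j] should act as 1, [x_i], 0. The form of a
    twisted commutator with [e] is the one that the intertwining lemmas take. *)
Definition left_rel (g : 'I_D) : ncpoly F D :=
  left_gen g * vE - vE * ncvar F g.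

Definition right_rel (g : 'I_D) : ncpoly F D :=
  right_gen g * (1 - vE) - (1 - vE) * ncvar F g.

(* In terms of the generators e, x_i, y_j these relations amount to e^2 = e,
   e x_i = x_i = x_i e, e y_j = 0 = y_j e, P_i(x) e = 0, P'_j(y) (1 - e) = 0. *)
Definition prod_rels : 'I_((D + D) + (r + r')) -> ncpoly F D :=
  fcase (fcase left_rel right_rel)
    (fcase (fun i => ncsubst vx (P i) * vE)
       (fun j => ncsubst vy (P' j) * (1 - vE))).

(** The arbitrary predicate serves vanishing, membership in the ideal and rank bounds alike. *)
Lemma prod_relsP (Q : ncpoly F D -> Prop) :
  (forall k, Q (prod_rels k)) <->
  [/\ forall g, Q (left_rel g), forall g, Q (right_rel g),
      forall i, Q (ncsubst vx (P i) * vE) &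
      forall j, Q (ncsubst vy (P' j) * (1 - vE))].
Proof.
rewrite /prod_rels; split=> [H|[Hl Hr HP HP']].
  split=> i.
  - by have := H (lshift _ (lshift _ i)); rewrite !fcase_lshift.
  - by have := H (lshift _ (rshift _ i)); rewrite fcase_lshift fcase_rshift.
  - by have := H (rshift _ (lshift _ i)); rewrite fcase_rshift fcase_lshift.
  - by have := H (rshift _ (rshift _ i)); rewrite !fcase_rshift.
apply: forall_split; apply: forall_split => k.
- rewrite !fcase_lshift; exact: Hl.
- rewrite fcase_lshift fcase_rshift; exact: Hr.
- rewrite fcase_rshift fcase_lshift; exact: HP.
- rewrite !fcase_rshift; exact: HP'.
Qed.

Section Eval.
Variables (S : algType F) (a : 'I_D -> S).

Lemma nceval_left_rel g : nceval a (left_rel g) =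
  gens 1 (a \o gx d') (fun=> 0) g * a (ge d d') - a (ge d d') * a g.
Proof.
rewrite /left_rel nceval_twist !nceval_var /left_gen.
rewrite (gens_map (nceval a)) nceval1.
by congr (_ * _ - _); apply: eq_gens => i /=; rewrite ?nceval_var ?raddf0.
Qed.

Lemma nceval_right_rel g : nceval a (right_rel g) =
  gens 0 (fun=> 0) (a \o gy d) g * (1 - a (ge d d'))
  - (1 - a (ge d d')) * a g.
Proof.
rewrite /right_rel nceval_twist ncevalB nceval1 !nceval_var.
rewrite /right_gen (gens_map (nceval a)) raddf0.
by congr (_ * _ - _); apply: eq_gens => i /=; rewrite ?nceval_var ?raddf0.
Qed.

Lemma nceval_left_poly i : nceval a (ncsubst vx (P i) * vE) =
  nceval (a \o gx d') (P i) * a (ge d d').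
Proof.
rewrite ncevalM nceval_ncsubst nceval_var; congr (_ * _).
by apply: eq_nceval => j; rewrite nceval_var.
Qed.

Lemma nceval_right_poly j : nceval a (ncsubst vy (P' j) * (1 - vE)) =
  nceval (a \o gy d) (P' j) * (1 - a (ge d d')).
Proof.
rewrite ncevalM nceval_ncsubst ncevalB nceval1 nceval_var; congr (_ * _).
by apply: eq_nceval => i; rewrite nceval_var.
Qed.

End Eval.

Lemma prod_rels_left (S : algType F) (x : 'I_d -> S) :
  (forall i, nceval x (P i) = 0) ->
  forall k, nceval (gens 1 x (fun=> 0)) (prod_rels k) = 0.
Proof.
move=> xP; apply/(prod_relsP (fun p => nceval _ p = 0)); split=> [g|g|i|j].
- rewrite nceval_left_rel !gensE mulr1 mul1r.
  apply/eqP; rewrite subr_eq0; apply/eqP.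
  by apply: eq_gens => // i; rewrite /= gensE.
- by rewrite nceval_right_rel !gensE subrr mulr0 mul0r subr0.
- rewrite nceval_left_poly !gensE.
  by rewrite mulr1 -[RHS](xP i); apply: eq_nceval => j; rewrite /= gensE.
- by rewrite nceval_right_poly !gensE subrr mulr0.
Qed.

Lemma prod_rels_right (S : algType F) (y : 'I_d' -> S) :
  (forall j, nceval y (P' j) = 0) ->
  forall k, nceval (gens 0 (fun=> 0) y) (prod_rels k) = 0.
Proof.
move=> yP'; apply/(prod_relsP (fun p => nceval _ p = 0)); split=> [g|g|i|j].
- by rewrite nceval_left_rel !gensE mulr0 mul0r subr0.
- rewrite nceval_right_rel !gensE subr0 mulr1 mul1r.
  apply/eqP; rewrite subr_eq0; apply/eqP.
  by apply: eq_gens => // j; rewrite /= gensE.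
- by rewrite nceval_left_poly !gensE mulr0.
- rewrite nceval_right_poly !gensE.
  by rewrite subr0 mulr1 -[RHS](yP' j); apply: eq_nceval => i; rewrite /= gensE.
Qed.

(** Here [u] is [e] or [1 - e], and [b0] rewrites a polynomial in the generators of one factor.
    Modulo the relations [u p] equals [b(p) u]; the latter vanishes because [u] moves past the [v i]
    until it meets some [P0 i]. *)
Lemma corner_ideal (d0 r0 : nat) (P0 : 'I_r0 -> ncpoly F d0) (u : ncpoly F D)
    (v : 'I_d0 -> ncpoly F D) (b : 'I_D -> ncpoly F D)
    (b0 : 'I_D -> ncpoly F d0) :
  (forall g, b g = ncsubst v (b0 g)) ->
  (forall g, in_ideal prod_rels (b g * u - u * ncvar F g)) ->
  (forall i, in_ideal prod_rels (v i * u - u * v i)) ->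
  (forall i, in_ideal prod_rels (ncsubst v (P0 i) * u)) ->
  forall p, in_ideal P0 (ncsubst b0 p) -> in_ideal prod_rels (u * p).
Proof.
move=> bE Ib Iv IP p [s b0p].
have Ibp : in_ideal prod_rels (ncsubst b p * u).
  rewrite (eq_ncsubst bE) -ncsubst_ncsubst b0p.
  rewrite ncsubst_sum mulr_suml.
  apply: (big_ind (in_ideal prod_rels)) => [||[[q i] q'] _].
  - exact: in_ideal0.
  - exact: in_idealD.
  - rewrite /= !ncsubstM.
    rewrite commute_last.
    exact (in_idealD (in_idealMl _ (in_ideal_intertwine Iv q'))
      (in_idealMr _ (in_idealMl _ (IP i)))).
have := in_idealB Ibp (in_ideal_intertwine Ib p).
by rewrite ncsubst_vars opprB addrC subrK.
Qed.

End ProductRels.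

Arguments left_rel {F d d'} g.
Arguments right_rel {F d d'} g.

(** * Stability of a product *)

Section ProductPresentation.
Variables (F : fieldType) (A A' : algType F) (d d' r r' : nat).
Variables (P : 'I_r -> ncpoly F d) (P' : 'I_r' -> ncpoly F d').
Variables (f : {lrmorphism ncpoly F d -> A}).
Variables (f' : {lrmorphism ncpoly F d' -> A'}).
Hypotheses (f_surj : forall a, exists p, f p = a)
  (f_ker : forall p, f p = 0 <-> in_ideal P p).
Hypotheses (f'_surj : forall a, exists p, f' p = a)
  (f'_ker : forall p, f' p = 0 <-> in_ideal P' p).

Local Notation D := (d + d' + 1)%N.
Let vE : ncpoly F D := ncvar F (ge d d').
Let vx (i : 'I_d) : ncpoly F D := ncvar F (gx d' i).
Let vy (j : 'I_d') : ncpoly F D := ncvar F (gy d j).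
Let a : 'I_D -> A := gens 1 (fun i => f (ncvar F i)) (fun=> 0).
Let a' : 'I_D -> A' := gens 0 (fun=> 0) (fun j => f' (ncvar F j)).

Let phi : {lrmorphism ncpoly F D -> (A * A')%type} :=
  nceval (fun g => (a g, a' g)).

Let fst_phi p : (phi p).1 = nceval a p.
Proof. exact: (lrmorph_nceval (fst : {lrmorphism (A * A')%type -> A})). Qed.

Let snd_phi p : (phi p).2 = nceval a' p.
Proof. exact: (lrmorph_nceval (snd : {lrmorphism (A * A')%type -> A'})). Qed.

Let a_vars p : nceval a (ncsubst vx p) = f p.
Proof.
rewrite nceval_ncsubst lrmorph_ncpoly; apply: eq_nceval => i.
by rewrite nceval_var /a gensE.
Qed.

Let a'_vars p : nceval a' (ncsubst vy p) = f' p.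
Proof.
rewrite nceval_ncsubst lrmorph_ncpoly; apply: eq_nceval => i.
by rewrite nceval_var /a' gensE.
Qed.

Let b0 : 'I_D -> ncpoly F d := gens 1 (@ncvar F d) (fun=> 0).
Let b0' : 'I_D -> ncpoly F d' := gens 0 (fun=> 0) (@ncvar F d').

Let f_b0 p : f (ncsubst b0 p) = nceval a p.
Proof.
rewrite lrmorph_ncsubst; apply: eq_nceval => g.
rewrite /b0 (gens_map f) rmorph1; apply: eq_gens => // j.
exact: raddf0.
Qed.

Let f'_b0' p : f' (ncsubst b0' p) = nceval a' p.
Proof.
rewrite lrmorph_ncsubst; apply: eq_nceval => g.
rewrite /b0' (gens_map f') raddf0; apply: eq_gens => // j.
exact: raddf0.
Qed.

Local Notation I := (in_ideal (prod_rels P P')).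

Let rels_I := (prod_relsP P P' I).1 (in_ideal_gen (prod_rels P P')).

Let left_ideal p : nceval a p = 0 -> I (vE * p).
Proof.
have [Il _ IP _] := rels_I.
rewrite -f_b0 => /f_ker; apply: (corner_ideal (v := vx) _ Il _ IP).
  move=> g; rewrite /b0 (gens_map (ncsubst vx)) ncsubst1.
  by apply: eq_gens => i /=; rewrite ?ncsubst_var ?ncsubst0.
by move=> i; have := Il (gx d' i); rewrite /left_rel gensE.
Qed.

Let right_ideal p : nceval a' p = 0 -> I ((1 - vE) * p).
Proof.
have [_ Ir _ IP'] := rels_I.
rewrite -f'_b0' => /f'_ker; apply: (corner_ideal (v := vy) _ Ir _ IP').
  move=> g; rewrite /b0' (gens_map (ncsubst vy)) ncsubst0.
  by apply: eq_gens => i /=; rewrite ?ncsubst_var ?ncsubst0.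
by move=> j; have := Ir (gy d j); rewrite /right_rel gensE.
Qed.

(** Lifts from the two factors are combined after multiplying by [e] and [1 - e]. The kernel is
    found by splitting [p] as [e p + (1 - e) p] and treating each corner in its own factor. *)
Lemma presents_prod : presents (prod_rels P P') (A * A')%type.
Proof.
exists phi; split=> [[x x']|p].
  have [p fp] := f_surj x; have [p' fp'] := f'_surj x'.
  exists (ncsubst vx p * vE + ncsubst vy p' * (1 - vE)).
  have phi1 : (phi (ncsubst vx p * vE)) = (x, 0).
    rewrite rmorphM; apply/eqP; rewrite xpair_eqE; apply/andP; split; apply/eqP.
    - by rewrite /= fst_phi a_vars fp fst_phi nceval_var /a gensE mulr1.
    - by rewrite /= [(phi vE).2]snd_phi nceval_var /a' gensE mulr0.
  have phi2 : (phi (ncsubst vy p' * (1 - vE))) = (0, x').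
    rewrite rmorphM rmorphB rmorph1.
    apply/eqP; rewrite xpair_eqE; apply/andP; split; apply/eqP.
    - by rewrite /= [(phi vE).1]fst_phi nceval_var /a gensE subrr mulr0.
    - rewrite /= snd_phi a'_vars fp' [(phi vE).2]snd_phi nceval_var /a' gensE.
      by rewrite subr0 mulr1.
  rewrite raddfD; apply: (etrans (congr2 +%R phi1 phi2)).
  by congr (_, _); rewrite /= ?addr0 ?add0r.
split=> [p0|].
  have ap : nceval a p = 0 by rewrite -fst_phi p0.
  have a'p : nceval a' p = 0 by rewrite -snd_phi p0.
  have := in_idealD (left_ideal ap) (right_ideal a'p).
  by rewrite mulrBl mul1r addrC subrK.
apply: lrmorph_ideal_eq0 => k.
have ak : nceval a (prod_rels P P' k) = 0.
  apply: prod_rels_left => i; rewrite -lrmorph_ncpoly.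
  by apply/f_ker; apply: in_ideal_gen.
have a'k : nceval a' (prod_rels P P' k) = 0.
  apply: prod_rels_right => j; rewrite -lrmorph_ncpoly.
  by apply/f'_ker; apply: in_ideal_gen.
by rewrite [LHS]surjective_pairing fst_phi snd_phi ak a'k.
Qed.

End ProductPresentation.

Section ProductStable.
Variables (F : fieldType) (d d' r r' : nat).
Variables (P : 'I_r -> ncpoly F d) (P' : 'I_r' -> ncpoly F d').
Local Notation D := (d + d' + 1)%N.

Lemma block_diag_mul_usub m1 m2 (X : 'M[F]_m1) (Y : 'M[F]_m2) :
  block_mx X 0 0 Y *m col_mx 1%:M 0 = col_mx 1%:M 0 *m X.
Proof.
rewrite mul_block_col mul_col_mx !(mulmx0, mul0mx, mulmx1, mul1mx).
by rewrite !addr0.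
Qed.

Lemma block_diag_mul_dsub m1 m2 (X : 'M[F]_m1) (Y : 'M[F]_m2) :
  block_mx X 0 0 Y *m col_mx 0 1%:M = col_mx 0 1%:M *m Y.
Proof.
rewrite mul_block_col mul_col_mx !(mulmx0, mul0mx, mulmx1, mul1mx).
by rewrite !add0r.
Qed.

(** The two block inclusions intertwine the block sum with solutions of the product relations, and
    side by side they form the identity. The index [m1 + m2.+1] stands for the size [m1.+1 + m2.+1],
    the two being convertible after the successor. *)
Lemma exact_sol_block m1 m2 (B1 : 'I_d -> 'M[F]_m1.+1)
    (B2 : 'I_d' -> 'M[F]_m2.+1) :
  exact_sol P B1 -> exact_sol P' B2 ->
  exact_sol (n := (m1 + m2.+1)%N) (prod_rels P P')
    (fun g => block_mx (gens 1 B1 (fun=> 0) g) 0 0 (gens 0 (fun=> 0) B2 g)).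
Proof.
move=> B1ex B2ex k.
set W := (fun g => _).
pose L1 : 'M[F]_(m1.+1 + m2.+1, m1.+1) := col_mx 1%:M 0.
pose L2 : 'M[F]_(m1.+1 + m2.+1, m2.+1) := col_mx 0 1%:M.
pose Wk : 'M[F]_(m1.+1 + m2.+1) := nceval W (prod_rels P P' k).
have WL1 : Wk *m L1 = 0.
  rewrite /Wk (@nceval_intertwine _ _ _ _ _ (gens 1 B1 (fun=> 0)) W L1) => [|g].
    by rewrite prod_rels_left // mulmx0.
  exact (block_diag_mul_usub (gens 1 B1 (fun=> 0) g) (gens 0 (fun=> 0) B2 g)).
have WL2 : Wk *m L2 = 0.
  rewrite /Wk (@nceval_intertwine _ _ _ _ _ (gens 0 (fun=> 0) B2) W L2) => [|g].
    by rewrite prod_rels_right // mulmx0.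
  exact (block_diag_mul_dsub (gens 1 B1 (fun=> 0) g) (gens 0 (fun=> 0) B2 g)).
have : Wk *m row_mx L1 L2 = 0 by rewrite mul_mx_row WL1 WL2 row_mx0.
by rewrite -block_mxEh -scalar_mx_block mulmx1.
Qed.

(* Here [bz] is the value that the generator [z] would have if it acted on the
   corner cut out by [e] and vanished on the complementary one. *)
Lemma corner_dist (n m t k : nat) (T : 'M[F]_(m, n)) (e e' z bz : 'M[F]_n)
    (b : 'M[F]_m) :
  T *m e' = T -> (\rank (e - e')%R <= t)%N ->
  (\rank (bz *m e - e *m z)%R <= t)%N -> (\rank (b *m T - T *m bz)%R <= k)%N ->
  (\rank (b *m T - T *m z)%R <= k + 3 * t)%N.
Proof.
move=> Te' ee' ez bT.
(* As [T e' = T], an [e'] may be inserted after [T]. It is exchanged with [e] once on either side of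
   the passage from [bz] to [z]; these three moves cost [t] each. *)
have -> : b *m T - T *m z = (b *m T - T *m bz) *m e' + T *m bz *m (e' - e)
    + T *m (bz *m e - e *m z) + T *m (e - e') *m z.
  rewrite !mulmxBr !mulmxBl Te' !mulmxA.
  rewrite -[b *m T *m e']mulmxA Te' [b *m T - _ + _]subrKA.
  by rewrite !subrKA.
apply: leq_trans (mxrank_add _ _) _.
have := mxrank_add ((b *m T - T *m bz) *m e' + T *m bz *m (e' - e))
  (T *m (bz *m e - e *m z)).
have := mxrank_add ((b *m T - T *m bz) *m e') (T *m bz *m (e' - e)).
have := mxrankM_maxl (b *m T - T *m bz) e'.
have := mxrankM_maxr (T *m bz) (e' - e).
have := mxrankM_maxr T (bz *m e - e *m z).
have := mxrankM_maxl (T *m (e - e')) z.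
have := mxrankM_maxr T (e - e').
rewrite [\rank (e' - e)%R]mxrank_subC.
move: ee' ez bT; rank_lia.
Qed.

Lemma mxrank_col_le (n m1 m2 : nat) (X : 'M[F]_(m1, n)) (Y : 'M[F]_(m2, n)) :
  (\rank (col_mx X Y) <= \rank X + \rank Y)%N.
Proof. by rewrite -addsmxE mxrank_adds_leqif. Qed.

(** A vector in both row spaces is fixed by [e] because of [T1] and killed by [e] because of
    [T2]. *)
Lemma mxrank_col_complement (n m1 m2 : nat) (T1 : 'M[F]_(m1, n))
    (T2 : 'M[F]_(m2, n)) (e : 'M[F]_n) :
  T1 *m e = T1 -> T2 *m (1%:M - e) = T2 -> e *m e = e ->
  \rank (col_mx T1 T2) = (\rank T1 + \rank T2)%N.
Proof.
move=> T1e T2e ee; rewrite -addsmxE mxrank_disjoint_sum //.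
apply/eqP; rewrite -submx0.
have /submxP[D1 E1] := capmxSl T1 T2; have /submxP[D2 E2] := capmxSr T1 T2.
have -> : (T1 :&: T2)%MS = (T1 :&: T2)%MS *m e by rewrite E1 -mulmxA T1e.
by rewrite E2 -T2e -!mulmxA mulmxBl mul1mx ee subrr !mulmx0 sub0mx.
Qed.

Lemma sim_stable_prod m0 (B0 : 'I_d -> 'M[F]_m0.+1) m0'
    (B0' : 'I_d' -> 'M[F]_m0'.+1) :
  exact_sol P B0 -> exact_sol P' B0' -> sim_stable P -> sim_stable P' ->
  sim_stable (prod_rels P P').
Proof.
move=> B0ex B0'ex st st' q.
have [p1 [N1 H1]] := corner_sol st B0ex (3 * q).
have [p2 [N2 H2]] := corner_sol st' B0'ex (3 * q).
(* The final distance [k1 + k2 + 6 * t] is paid in thirds, which explains [3 * q] and [18 * q]. Once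
   [t] is positive, the summands [N1] and [N2] force [n.+1] to be large enough for [corner_sol]. *)
exists (p1 + p2 + N1 + N2 + 18 * q).+1 => // n Z approx.
pose t := \max_k \rank (nceval Z (prod_rels P P' k)).
have pt : ((p1 + p2 + N1 + N2 + 18 * q).+1 * t <= n.+1)%N.
  rewrite /t; elim/big_ind: _ => [|x y|k _]; rewrite ?muln0 //.
  by rewrite maxnMr geq_max => -> ->.
have [t0 | tpos] := posnP t.
  exists n, Z, 1%:M, 0%N; split; rewrite ?muln0 //.
    move=> k; apply/eqP; rewrite -mxrank_eq0 -leqn0.
    apply: leq_trans (_ : t <= _)%N.
      exact: (leq_bigmax k).
    by rewrite t0.
  by split=> [||g]; rewrite ?mxrank1 ?addn0 // mulmx1 mul1mx subrr mxrank0.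
have [Ht1 Ht2 Ht3 Ht4] :=
  (prod_relsP P P' (fun p => (\rank (nceval Z p) <= t)%N)).1
    (fun k => leq_bigmax k).
pose e := Z (ge d d').
have {}Ht1 g :
    (\rank (gens 1 (Z \o gx d') (fun=> 0) g *m e - e *m Z g)%R <= t)%N.
  by have := Ht1 g; rewrite nceval_left_rel.
have {}Ht2 g : (\rank (gens 0 (fun=> 0) (Z \o gy d) g *m (1%:M - e)
    - (1%:M - e) *m Z g)%R <= t)%N.
  by have := Ht2 g; rewrite nceval_right_rel.
have {}Ht3 i : (\rank (nceval (Z \o gx d') (P i) *m e) <= t)%N.
  by have := Ht3 i; rewrite nceval_left_poly.
have {}Ht4 j : (\rank (nceval (Z \o gy d) (P' j) *m (1%:M - e)) <= t)%N.
  by have := Ht4 j; rewrite nceval_right_poly.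
have [e' e'e' ee'] := idempotent_near e.
have {}ee' : (\rank (e - e')%R <= t)%N.
  (* The relation [left_rel] at the generator [e] is [e - e * e]. *)
  by apply: leq_trans ee' _; have := Ht1 (ge d d'); rewrite gensE mul1mx.
have ce' : (1%:M - e') *m (1%:M - e') = 1%:M - e'.
  by rewrite mulmxBl mul1mx mulmxBr mulmx1 e'e' subrr subr0.
have cee' : (\rank ((1%:M - e) - (1%:M - e'))%R <= t)%N.
  by rewrite opprB addrC subrKA mxrank_subC.
have [||i|i|m1 [B1 [T1 [k1 [B1ex T1e' qk1 [rT1 mT1] B1T1]]]]] :=
    H1 n t (Z \o gx d') e e' e'e' _ _ ee'.
- by move: pt tpos; clear; nia.
- by move: pt; clear; nia.
- by have := Ht1 (gx d' i); rewrite gensE.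
- exact: Ht3.
have [||i|i|m2 [B2 [T2 [k2 [B2ex T2e' qk2 [rT2 mT2] B2T2]]]]] :=
    H2 n t (Z \o gy d) (1%:M - e) (1%:M - e') ce' _ _ cee'.
- by move: pt tpos; clear; nia.
- by move: pt; clear; nia.
- by have := Ht2 (gy d i); rewrite gensE.
- exact: Ht4.
exists (m1 + m2.+1)%N, (fun g => block_mx (gens 1 B1 (fun=> 0) g) 0 0
   (gens 0 (fun=> 0) B2 g)), (col_mx T1 T2), (k1 + k2 + 6 * t)%N.
split; first exact: exact_sol_block.
  by move: qk1 qk2 pt; clear; nia.
have rT := mxrank_col_complement T1e' T2e' e'e'.
split.
- rewrite [\rank _]rT.
  (* The ranks of the complementary idempotents add up to at least [n.+1], so the two corners
     together lose at most [k1 + k2]. *)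
  have := mxrank_add e' (1%:M - e'); rewrite addrC subrK mxrank1.
  by move: rT1 rT2; rank_lia.
- rewrite [\rank _]rT.
  by move: mT1 mT2; rank_lia.
- move=> g.
  have -> : block_mx (gens 1 B1 (fun=> 0) g) 0 0 (gens 0 (fun=> 0) B2 g) *m
      col_mx T1 T2 - col_mx T1 T2 *m Z g =
      col_mx (gens 1 B1 (fun=> 0) g *m T1 - T1 *m Z g)
        (gens 0 (fun=> 0) B2 g *m T2 - T2 *m Z g).
    rewrite mul_block_col mul_col_mx !mul0mx addr0 add0r opp_col_mx add_col_mx.
    by [].
  apply: leq_trans (mxrank_col_le (gens 1 B1 (fun=> 0) g *m T1 - T1 *m Z g)
    (gens 0 (fun=> 0) B2 g *m T2 - T2 *m Z g)) _.
  have [c1 c2] :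
      (\rank (gens 1 B1 (fun=> 0) g *m T1
               - T1 *m gens 1 (Z \o gx d') (fun=> 0) g)%R <= k1)%N /\
      (\rank (gens 0 (fun=> 0) B2 g *m T2
               - T2 *m gens 0 (fun=> 0) (Z \o gy d) g)%R <= k2)%N.
    elim/gens_ind: g => [|i|j]; rewrite !gensE.
    - by rewrite mul1mx mulmx1 mul0mx mulmx0 !subrr !mxrank0.
    - by rewrite mul0mx mulmx0 subrr mxrank0; split=> //; apply: B1T1.
    - by rewrite mul0mx mulmx0 subrr mxrank0; split=> //; apply: B2T2.
  have := corner_dist T1e' ee' (Ht1 g) c1.
  have := corner_dist T2e' cee' (Ht2 g) c2.
  rank_lia.
Qed.

End ProductStable.

(** The images of the generators under a representation are the fixed solution that replaces a small
    corner. *)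
Lemma rep_exact_sol (F : fieldType) (d r : nat) (P : 'I_r -> ncpoly F d)
    (A : algType F) : presents P A -> has_findim_rep A ->
  exists m (B : 'I_d -> 'M[F]_m.+1), exact_sol P B.
Proof.
move=> [f [_ f_ker]] [m [h]].
exists m, (fun i => h (f (ncvar F i))) => i.
rewrite -(lrmorph_nceval h) -lrmorph_ncpoly.
by rewrite (_ : f (P i) = 0) ?raddf0 //; apply/f_ker; apply: in_ideal_gen.
Qed.

Theorem theorem7p2 (R : realType) (F : fieldType) (A A' : algType F)
    (hA : finitely_presented A) (hA' : finitely_presented A')
    (repA : has_findim_rep A) (repA' : has_findim_rep A') :
  rank_stable R (A * A')%type <-> rank_stable R A /\ rank_stable R A'.
Proof.
split=> [st|[[d [r [P [PA stP]]]] [d' [r' [P' [PA' stP']]]]]].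
  split.
    pose pr1 : {lrmorphism (A * A')%type -> A} := fst.
    apply: (@rank_stable_quotient R F _ _ pr1 (1, 0) _ _ _ _ st).
    - by move=> a; exists (a, 0).
    - by congr (_, _); rewrite /= ?mulr1 ?mulr0.
    - by move=> [a a']; congr (_, _); rewrite /= ?mulr1 ?mul1r ?mulr0 ?mul0r.
    - move=> [a a']; split=> /= [->|[]]; last by rewrite mul1r.
      by congr (_, _); rewrite /= ?mulr0 ?mul0r.
  pose pr2 : {lrmorphism (A * A')%type -> A'} := snd.
  apply: (@rank_stable_quotient R F _ _ pr2 (0, 1) _ _ _ _ st).
  - by move=> a; exists (0, a).
  - by congr (_, _); rewrite /= ?mulr1 ?mulr0.
  - by move=> [a a']; congr (_, _); rewrite /= ?mulr1 ?mul1r ?mulr0 ?mul0r.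
  - move=> [a a']; split=> /= [->|[_]]; last by rewrite mul1r.
    by congr (_, _); rewrite /= ?mulr0 ?mul0r.
have [m0 [B0 B0ex]] := rep_exact_sol PA repA.
have [m0' [B0' B0'ex]] := rep_exact_sol PA' repA'.
exists (d + d' + 1)%N, (d + d' + 1 + (d + d' + 1) + (r + r'))%N.
exists (prod_rels P P').
case: PA => f [f_surj f_ker]; case: PA' => f' [f'_surj f'_ker].
split; first exact: presents_prod f_surj f_ker f'_surj f'_ker.
apply/rank_stable_simP; apply: sim_stable_prod B0ex B0'ex _ _.
  exact/rank_stable_simP/stP.
exact/rank_stable_simP/stP'.
Qed.
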